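(* Let $k\ge 1$ and let $\lambda$ be a strict partition with $k$-abacus representation $(\alpha^{(1)},\dots,\alpha^{(k)})$. Then $$RQ^{(k)}_\lambda(X)=Q_{\alpha^{(k)}}(X)\prod_{1\le i\le\lfloor k/2\rfloor}Q_{\mu_i}(X).$$ Here, for $i<k/2$, $\mu_i$ is the underlying shape of the folded diagram $\alpha^{(i)}\diamond\alpha^{(k-i)}$, and for $i=k/2$ (when $k$ is even), $\mu_i$ is the underlying shape of $\alpha^{(k/2)}\diamond\varnothing$.
   Context: Conventions. Diagrams are drawn in French convention, with rows numbered from the bottom. A strict partition $\lambda=(\lambda_1>\cdots>\lambda_\ell>0)$ is identified with its shifted diagram $\{(c,r):1\le r\le \ell,\ r\le c\le r+\lambda_r-1\}$. The diagonal value of a cell is $\mathrm{diag}(c,r)=c-r+1$, and the main diagonal consists of the cells of value $1$. A subset $R\subseteq\lambda$ is removable if $\lambda\setminus R$ is a shifted diagram. Ribbons. A single ribbon is a nonempty edge-connected skew-shifted diagram whose cells lie on distinct diagonals. Its head $H(R)$ and tail $T(R)$ are its cells of largest and smallest diagonal value. A double ribbon in $\lambda$ is a union $R\cup S$ of disjoint single ribbons with $|R|\ge|S|$ such that $T(R)$ is on the main diagonal of $\lambda$, $T(S)$ is on the main diagonal of $\lambda\setminus R$, and $R\cup S$ is skew-shifted. Its head is $H(R)$. A $k$-ribbon is a single or double ribbon with $k$ cells. A $k$-core is a shifted diagram with no removable $k$-ribbon. Strips. A horizontal (resp. vertical) $k$-ribbon strip $\lambda\setminus\lambda^{(0)}$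 is given by a chain $\lambda^{(0)}\subset\cdots\subset\lambda^{(t)}=\lambda$ such that each $R_i=\lambda^{(i)}\setminus\lambda^{(i-1)}$ is a removable $k$-ribbon of $\lambda^{(i)}$, and $H(R_i)$ is in a column strictly right of (resp. a row strictly above) $H(R_{i-1})$. Semi-standard shifted $k$-ribbon tableau of shape $\lambda$. This is a chain $\lambda^{(0)}\subseteq\lambda^{(1')}\subseteq\lambda^{(1)}\subseteq\lambda^{(2')}\subseteq\cdots\subseteq\lambda^{(m)}=\lambda$, together with the ribbon decompositions of the strips, such that: - $\lambda^{(0)}$ is a $k$-core; - $\lambda^{(i')}\setminus\lambda^{(i-1)}$ is a vertical $k$-ribbon strip, whose ribbons are labelled $i'$; - $\lambda^{(i)}\setminus\lambda^{(i')}$ is a horizontal $k$-ribbon strip, whose ribbons are labelled $i$. The ribbon Q-function is $RQ^{(k)}_\lambda(X)=\sum_S X^{|S|}$, summed over these tableaux, where $X^{|S|}=\prod_i x_i^{\#\{\text{ribbons labelled } i \text{ or } i'\}}$. Schur Q-functions. A semi-standard shifted tableau of skew-shifted shape $\lambda\setminus\mu$ is a filling by the marked alphabet $1'<1<2'<2<\cdots$ such that: - rows weakly increase left to right and columns weakly increase bottom to top; - no marked letter is repeated in a row; - no unmarked letter is repeated in a column. Define $Q_{\lambda\setminus\mu}(X)=\sum_S X^{|S|}$, with $X^{|S|}=\prod_i x_i^{\#\{\text{cells containing } i \text{ or } i'\}}$, and $Q_\lambda=Q_{\lambda\setminus\varnothing}$. For an ordinary (unshifted) partition $\gamma$ with $\ell$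 rows, let $\gamma+\delta_\ell$ be the strict partition with parts $\gamma_j+\ell-j+1$ and $\delta_\ell=(\ell,\ell-1,\dots,1)$. Then set $Q_\gamma:=Q_{(\gamma+\delta_\ell)\setminus\delta_\ell}$; the skew-shifted diagram $(\gamma+\delta_\ell)\setminus\delta_\ell$ is a translate of the Young diagram of $\gamma$. Abacus representation. $\alpha^{(i)}$ is the strict partition with parts $(p-i)/k+1$, where $p$ runs over the parts of $\lambda$ with $p\equiv i\pmod k$. Combination. For strict partitions $\alpha$ and $\beta$ with $a$ and $b$ rows, let $n=\min(a,b)$. Then $\alpha\diamond\beta=(C,\{x=y\})$, where $$C=\{(y-(a-n),x-(a-n)):(x,y)\in\alpha,\ x>a-n\}\cup\{(x-(b-n),y-(b-n)):(x,y)\in\beta,\ x>b-n\}.$$ The set $C$ is a translate of a Young diagram, whose partition is the underlying shape. *)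

(* Defs.v *)
From mathcomp Require Import all_boot all_order all_algebra.
From mathcomp Require Import finmap mpoly.
From mathcomp Require Import boolp classical_sets fsbigop.

Set Implicit Arguments.
Unset Strict Implicit.
Unset Printing Implicit Defensive.

Import GRing.Theory.

Local Open Scope fset_scope.
Local Open Scope nat_scope.

(* Cells are pairs (column, row), both numbered from 1, rows from the bottom. *)
Definition cell : choiceType := (nat * nat)%type.
Definition diagram : choiceType := {fset cell}.

Definition diag (x : cell) : nat := x.1 - x.2 + 1.

Definition strict_partition (la : seq nat) : bool :=
  sorted gtn la && (0 \notin la).

Definition shdiag (la : seq nat) : diagram :=
  [fset x in [seq (c, r) | r <- iota 1 (size la), c <- iota r (nth 0 la r.-1)]].

Definition is_shifted (D : diagram) : Prop :=
  exists2 la, strict_partition la & D = shdiag la.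

Definition skew_shifted (U : diagram) : Prop :=
  exists la mu, [/\ is_shifted la, is_shifted mu, mu `<=` la & U = la `\` mu].

Definition removable (D R : diagram) : Prop :=
  [/\ is_shifted D, R `<=` D & is_shifted (D `\` R)].

Definition main_diagonal (D : diagram) : diagram := [fset x in D | diag x == 1].

(** Ribbons *)

Definition adjacent : rel cell := fun x y =>
  ((x.1 == y.1) && ((x.2 == y.2.+1) || (y.2 == x.2.+1))) ||
  ((x.2 == y.2) && ((x.1 == y.1.+1) || (y.1 == x.1.+1))).

Definition edge_connected (R : diagram) : Prop :=
  forall x y : R, connect (fun a b : R => adjacent (val a) (val b)) x y.

Definition single_ribbon (R : diagram) : Prop :=
  [/\ R != fset0, edge_connected R, skew_shifted R & {in R &, injective diag}].

Definition is_head (R : diagram) (h : cell) : Prop :=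
  h \in R /\ {in R, forall x, diag x <= diag h}.

Definition is_tail (R : diagram) (t : cell) : Prop :=
  t \in R /\ {in R, forall x, diag t <= diag x}.

Definition double_ribbon (D R S : diagram) : Prop :=
  [/\ single_ribbon R, single_ribbon S, [disjoint R & S], R `|` S `<=` D &
      #|` S| <= #|` R|] /\
  [/\ exists2 t, is_tail R t & t \in main_diagonal D,
      exists2 t, is_tail S t & t \in main_diagonal (D `\` R) &
      skew_shifted (R `|` S)].

(* U is a k-ribbon of D with head h.  A ribbon is only a set of cells: a
   decomposition of a double ribbon into two single ones is not part of it. *)
Definition kribbon_with_head (k : nat) (D U : diagram) (h : cell) : Prop :=
  #|` U| = k /\
  ([/\ U `<=` D, single_ribbon U & is_head U h] \/
   exists R S, [/\ double_ribbon D R S, U = R `|` S & is_head R h]).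

Definition kribbon (k : nat) (D U : diagram) : Prop :=
  exists h, kribbon_with_head k D U h.

Definition kcore (k : nat) (D : diagram) : Prop :=
  is_shifted D /\ forall U, removable D U -> ~ kribbon k D U.

(** Ribbon strips *)

(* The sequence c = [:: D_1; ...; D_t] decomposes a strip from D_0 to D_t = D;
   consecutive heads are compared by before. *)
Definition ribbon_strip (before : rel cell) (k : nat)
    (D0 : diagram) (c : seq diagram) (D : diagram) : Prop :=
  let shape i := nth fset0 (D0 :: c) i in
  let ribbon i := shape i `\` shape i.-1 in
  [/\ last D0 c = D,
      forall i, 1 <= i <= size c ->
        [/\ shape i.-1 `<=` shape i, removable (shape i) (ribbon i) &
            kribbon k (shape i) (ribbon i)] &
      forall i, 2 <= i <= size c ->
        exists h' h,
          [/\ kribbon_with_head k (shape i.-1) (ribbon i.-1) h',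
              kribbon_with_head k (shape i) (ribbon i) h & before h' h]].

Definition horizontal_strip := ribbon_strip (fun h' h => h'.1 < h.1).
Definition vertical_strip := ribbon_strip (fun h' h => h'.2 < h.2).

(** Ribbon tableaux and the ribbon Q-function in the variables x_1, ..., x_m *)

(* The shapes lambda^(i), 0 <= i <= m, the shapes lambda^(i'), and the chains
   decomposing the vertical and the horizontal strips. The letters i', i with
   1 <= i <= m are indexed by i - 1 : 'I_m. *)
Definition tableau_data (m : nat) : choiceType :=
  ({ffun 'I_m.+1 -> diagram} * {ffun 'I_m -> diagram} *
   {ffun 'I_m -> seq diagram} * {ffun 'I_m -> seq diagram})%type.

Definition ribbon_tableau (k m : nat) (D : diagram) (S : tableau_data m) : Prop :=
  let: (lam, lam', vert, horiz) := S in
  [/\ kcore k (lam ord0),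
      forall i : 'I_m,
        vertical_strip k (lam (widen_ord (leqnSn m) i)) (vert i) (lam' i),
      forall i : 'I_m,
        horizontal_strip k (lam' i) (horiz i) (lam (lift ord0 i)) &
      lam ord_max = D].

Definition tableau_weight (m : nat) (S : tableau_data m) : {mpoly int[m]} :=
  let: (_, _, vert, horiz) := S in
  (\prod_(i < m) 'X_i ^+ (size (vert i) + size (horiz i)))%R.

(* For k >= 1 there are finitely many tableaux of a given shape, so the
   finitely supported sum is the sum over all of them. *)
Definition RQ (k m : nat) (la : seq nat) : {mpoly int[m]} :=
  (\sum_(S \in [set S : tableau_data m | ribbon_tableau k (shdiag la) S]%classic)
     tableau_weight S)%R.

(** Schur Q-functions in the variables x_1, ..., x_m *)

(* (i, true) is the marked letter (i+1)' and (i, false) the letter i+1. *)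
Definition letter (m : nat) : finType := ('I_m * bool)%type.
Definition marked (m : nat) (a : letter m) : bool := a.2.
Definition letter_rank (m : nat) (a : letter m) : nat := a.1.*2 + ~~ marked a.
Definition letter_le (m : nat) (a b : letter m) : bool :=
  letter_rank a <= letter_rank b.

Definition semistandard (m : nat) (U : diagram) (T : {ffun U -> letter m}) : bool :=
  [forall x : U, forall y : U,
    (((val x).2 == (val y).2) && ((val x).1 < (val y).1) ==>
       letter_le (T x) (T y) && ~~ ((T x == T y) && marked (T x))) &&
    (((val x).1 == (val y).1) && ((val x).2 < (val y).2) ==>
       letter_le (T x) (T y) && ~~ ((T x == T y) && ~~ marked (T x)))].

Definition Qskew (m : nat) (la mu : seq nat) : {mpoly int[m]} :=
  (\sum_(T : {ffun shdiag la `\` shdiag mu -> letter m} | semistandard T)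
     \prod_x 'X_((T x).1))%R.

Definition Qstrict (m : nat) (la : seq nat) : {mpoly int[m]} := Qskew m la [::].

(* ga + delta_l and delta_l, with parts indexed from 0. *)
Definition delta (l : nat) : seq nat := mkseq (fun j => l - j) l.
Definition plus_delta (ga : seq nat) : seq nat :=
  mkseq (fun j => nth 0 ga j + (size ga - j)) (size ga).

Definition Qpartition (m : nat) (ga : seq nat) : {mpoly int[m]} :=
  Qskew m (plus_delta ga) (delta (size ga)).

(** Abacus representation and folded diagrams *)

Definition abacus (k : nat) (la : seq nat) (i : nat) : seq nat :=
  [seq (p - i) %/ k + 1 | p <- la & p == i %[mod k]].

(* Cells of a folded diagram may have nonpositive coordinates. The second
   component is the fold line x = y. *)
Definition folded_diagram : Type := ({fset int * int} * pred (int * int))%type.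

Definition combination (al be : seq nat) : folded_diagram :=
  let a := size al in
  let b := size be in
  let n := minn a b in
  ([fset ((p.2%:Z - (a - n)%:Z)%R, (p.1%:Z - (a - n)%:Z)%R)
     | p in [fset p in shdiag al | a - n < p.1]] `|`
   [fset ((p.1%:Z - (b - n)%:Z)%R, (p.2%:Z - (b - n)%:Z)%R)
     | p in [fset p in shdiag be | b - n < p.1]],
   fun p => p.1 == p.2).

Definition partition_seq (ga : seq nat) : bool := sorted geq ga && (0 \notin ga).

Definition young_diagram (ga : seq nat) : diagram :=
  [fset x in [seq (c, r) | r <- iota 1 (size ga), c <- iota 1 (nth 0 ga r.-1)]].

Definition is_translate (C : {fset int * int}) (D : diagram) : Prop :=
  exists u v : int, C = [fset ((x.1%:Z + u)%R, (x.2%:Z + v)%R) | x in D].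

(* The partition whose Young diagram is a translate of the cells of F. *)
Definition underlying_shape (F : folded_diagram) : seq nat :=
  xget [::] [set ga | partition_seq ga /\ is_translate F.1 (young_diagram ga)]%classic.

Definition folded_shape (k : nat) (la : seq nat) (i : nat) : seq nat :=
  underlying_shape
    (if i.*2 < k then combination (abacus k la i) (abacus k la (k - i))
     else combination (abacus k la i) [::]).

(* Main.v *)
Require Import Defs.
From mathcomp Require Import all_boot all_order all_algebra.
From mathcomp Require Import finmap mpoly zify ring.
From mathcomp Require Import boolp classical_sets fsbigop.

(** Record a shape by the set of its parts, seen as beads. Removing a k-ribbon
    whose head lies on the diagonal p moves the bead p to p - k, or deletes the
    beads p and k - p when p < k; and the heads of consecutive ribbons of a
    horizontal (vertical) strip are ordered as required iff their diagonals
    increase (decrease). So RQ is obtained by letting the operators 1 + x mv_p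
    act, for each letter, first with p decreasing and then with p increasing.
    For k = 1 the same operators compute the skew Schur Q-functions.

    The operators of the runners i and k - i only move beads of these two
    runners, so RQ factors over the pairs of runners. A pair of runners is a
    two-sided Maya diagram, that is an unshifted partition, on which the
    positions are visited in the order 0, -1, 1, -2, 2, ... away from the fold.
    The operators u_j moving the bead j to j - 1 satisfy the nil-Temperley-Lieb
    relations, whence the Yang-Baxter identity
    h_j h_{j+1}^2 h_j = h_{j+1} h_j^2 h_{j+1} for h_j = 1 + x u_j. It turns the
    folded order into the natural order of the positions, for which the
    operators compute the Q-function of the unfolded shape. *)

Set Implicit Arguments.
Unset Strict Implicit.
Unset Printing Implicit Defensive.

Import GRing.Theory.

Local Open Scope fset_scope.
Local Open Scope nat_scope.

(** * Words of removal operators *)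

(** The two passes of a letter cannot be reordered separately: [h_j h_{j+1} h_j] and
    [h_{j+1} h_j h_{j+1}] already differ in degree one. Only the whole two-pass word in a single
    variable can be, which is why [weq] compares the words of one letter.

    The pair of runners [i], [k - i] becomes one Maya diagram by recording the gaps of runner [i]
    instead of its beads, read backwards. A single ribbon on either runner and a double ribbon
    across both then become the same move of one bead to its left neighbour, and only the order of
    the visits remembers the fold.

    Every word ends with an indicator: of a [k]-core for ribbon tableaux, of the inner shape for
    Q-functions. The two match because the number of beads above the filled part is conserved, and a
    diagram without moves has these beads packed, which is the staircase [delta l]. The lowest hole
    of the initial diagram serves as origin: a bead at or below it can never move, so an infinite
    diagram is cut down to a strict partition. *)

Section WordOperators.
Variables (R : comNzRingType) (S P : Type) (D : P -> S -> option S).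
Implicit Types (w : seq (R * P)) (f : S -> R) (s : S) (ps : seq P).

(** The operators [1 + x D_p] act on the state from the left end of the word on; [f] evaluates the
    final state and [None] is the zero vector. *)
Fixpoint opw w f s : R :=
  if w is (x, p) :: w' then
    (opw w' f s + x * oapp (opw w' f) 0 (D p s))%R
  else f s.

Lemma eq_opw w f g : f =1 g -> opw w f =1 opw w g.
Proof.
move=> fg; elim: w => //= -[x p] w IHw s.
by rewrite IHw; case: (D p s) => //= s'; rewrite IHw.
Qed.

Lemma opw_cat w1 w2 f s : opw (w1 ++ w2) f s = opw w1 (opw w2 f) s.
Proof.
elim: w1 s => //= -[x p] w IHw s.
by rewrite IHw; case: (D p s) => //= s'; rewrite IHw.
Qed.

Definition letterw (x : R) ps : seq (R * P) := [seq (x, p) | p <- ps].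

Definition wordw (xs : seq R) ps : seq (R * P) := [seq (x, p) | x <- xs, p <- ps].

Definition weq ps ps' := forall (x : R) f s,
  opw (letterw x ps) f s = opw (letterw x ps') f s.

Lemma opw_letter_cat x ps ps' f s :
  opw (letterw x (ps ++ ps')) f s = opw (letterw x ps) (opw (letterw x ps') f) s.
Proof. by rewrite /letterw map_cat opw_cat. Qed.

Lemma weq_trans ps2 ps1 ps3 : weq ps1 ps2 -> weq ps2 ps3 -> weq ps1 ps3.
Proof. by move=> h1 h2 x f s; rewrite h1 h2. Qed.

Lemma weq_refl ps : weq ps ps. Proof. by []. Qed.

Lemma weq_sym ps ps' : weq ps ps' -> weq ps' ps.
Proof. by move=> h x f s; rewrite h. Qed.

Lemma weq_cat ps1 ps1' ps2 ps2' :
  weq ps1 ps1' -> weq ps2 ps2' -> weq (ps1 ++ ps2) (ps1' ++ ps2').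
Proof.
move=> h1 h2 x f s; rewrite !opw_letter_cat h1.
by apply: eq_opw => t; rewrite h2.
Qed.

Lemma weq_word xs ps ps' f s :
  weq ps ps' -> opw (wordw xs ps) f s = opw (wordw xs ps') f s.
Proof.
move=> h; elim: xs s => //= x xs IHxs s.
by rewrite !opw_cat -!/(letterw _ _) h; apply: eq_opw.
Qed.

Lemma wordw_cons x xs ps : wordw (x :: xs) ps = letterw x ps ++ wordw xs ps.
Proof. by []. Qed.

End WordOperators.

(** * Invariants: dropping positions and changing the kind of state *)

Section Filter.
Variables (R : comNzRingType) (S : Type) (P : eqType) (D : P -> S -> option S).

(** A position whose move vanishes on every state satisfying the invariant [I] contributes only the
    factor 1. *)
Lemma opw_drop (I : S -> Prop) (Q : pred P) (xs : seq R) (ps : seq P) f s :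
    (forall p s s', p \in ps -> I s -> D p s = Some s' -> I s') ->
    (forall p s, p \in ps -> ~~ Q p -> I s -> D p s = None) ->
    I s -> opw D (wordw xs ps) f s = opw D (wordw xs (filter Q ps)) f s.
Proof.
move=> Iinv ID; elim: xs s => //= x xs IHxs s Is.
rewrite !wordw_cons.
suff: forall ps', {subset ps' <= ps} ->
  opw D (letterw x ps' ++ wordw xs ps) f s =
  opw D (letterw x (filter Q ps') ++ wordw xs (filter Q ps)) f s by exact.
move=> ps'; elim: ps' s Is => //= [|p ps' IHps] s Is sub; first exact: IHxs.
have pps: p \in ps by apply: sub; rewrite mem_head.
have sub': {subset ps' <= ps} by move=> q qps; apply: sub; rewrite inE qps orbT.
case: ifPn => [Qp|nQp] /=; last by rewrite ID //= mulr0 addr0 IHps.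
rewrite IHps //; case Dp: (D p s) => [s'|] //=.
by rewrite (IHps s') //; apply: Iinv Dp.
Qed.

Lemma filter_wordw (Q : pred P) (xs : seq R) ps :
  [seq v <- wordw xs ps | Q v.2] = wordw xs (filter Q ps).
Proof.
elim: xs => //= x xs IHxs; rewrite !wordw_cons filter_cat IHxs.
by congr cat; rewrite /letterw filter_map.
Qed.

(** [pi] intertwines the moves on the states satisfying [I], so both words expand into the same
    terms. This serves to pass from runners to Maya diagrams and from these to shifted shapes. *)
Lemma opw_sim (S' P' : Type) (D' : P' -> S' -> option S') (I : S -> Prop)
    (pi : S -> S') (phi : P -> P') (xs : seq R) (ps : seq P) f f' s :
    (forall p s s', p \in ps -> I s -> D p s = Some s' -> I s') ->
    (forall p s, p \in ps -> I s -> D' (phi p) (pi s) = omap pi (D p s)) ->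
    (forall s, I s -> f s = f' (pi s)) ->
    I s -> opw D (wordw xs ps) f s = opw D' (wordw xs (map phi ps)) f' (pi s).
Proof.
move=> Iinv ID ff'; elim: xs s => /= [|x xs IHxs] s Is; first exact: ff'.
rewrite !wordw_cons.
suff: forall ps', {subset ps' <= ps} ->
  opw D (letterw x ps' ++ wordw xs ps) f s =
  opw D' (letterw x (map phi ps') ++ wordw xs (map phi ps)) f' (pi s) by exact.
move=> ps'; elim: ps' s Is => //= [|p ps' IHps] s Is sub; first exact: IHxs.
have pps: p \in ps by apply: sub; rewrite mem_head.
have sub': {subset ps' <= ps} by move=> q qps; apply: sub; rewrite inE qps orbT.
rewrite IHps // ID //; case Dp: (D p s) => [s'|] //=.
by rewrite (IHps s') //; apply: Iinv Dp.
Qed.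

Lemma opw_ext_in (I : S -> Prop) (xs : seq R) (ps : seq P) f f' s :
    (forall p s s', p \in ps -> I s -> D p s = Some s' -> I s') ->
    (forall s, I s -> f s = f' s) ->
    I s -> opw D (wordw xs ps) f s = opw D (wordw xs ps) f' s.
Proof.
move=> Iinv ff' Is.
rewrite (@opw_sim _ _ D I id id xs ps f f' s) ?map_id // => p t _ _.
by case: (D p t).
Qed.

End Filter.

(** * Factorization over independent classes of positions *)

Section Factor.
Variables (R : comNzRingType) (S : Type) (P C : eqType) (D : P -> S -> option S).
Variables (cls : P -> C) (agree : C -> S -> S -> Prop) (I : S -> Prop).
Hypothesis D_inv : forall p s s', I s -> D p s = Some s' -> I s'.
Hypothesis D_agree_other : forall p s s' c,
  I s -> D p s = Some s' -> c != cls p -> agree c s s'.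
Hypothesis D_agree : forall p s t, I s -> I t -> agree (cls p) s t ->
  match D p s, D p t with
  | Some s', Some t' => agree (cls p) s' t'
  | None, None => True
  | _, _ => False
  end.

Lemma opw_agree c (w : seq (R * P)) f s t :
    (forall s t, I s -> I t -> agree c s t -> f s = f t) ->
    I s -> I t -> agree c s t ->
  opw D [seq v <- w | cls v.2 == c] f s = opw D [seq v <- w | cls v.2 == c] f t.
Proof.
move=> fc; elim: w s t => /= [|[x p] w IHw] s t Is It st; first exact: fc.
case: eqP => [cp|_] /=; last exact: IHw.
rewrite -cp in st; have := D_agree Is It st; rewrite cp in st *.
rewrite (IHw s t) //; case Ds: (D p s) => [s'|]; case Dt: (D p t) => [t'|] //= st'.
by rewrite (IHw s' t') //; [apply: D_inv Ds|apply: D_inv Dt].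
Qed.

(** Induction on the word: a move at [p] changes only the component of the class of [p], so its term
    belongs to that one factor. The other factors take the same value before and after the move, by
    [opw_agree]. *)
Lemma opw_factor (cs : seq C) (w : seq (R * P)) (f : C -> S -> R) s :
    uniq cs -> (forall v, v \in w -> cls v.2 \in cs) ->
    (forall c s t, I s -> I t -> agree c s t -> f c s = f c t) -> I s ->
  opw D w (fun s => \prod_(c <- cs) f c s)%R s =
  (\prod_(c <- cs) opw D [seq v <- w | cls v.2 == c] (f c) s)%R.
Proof.
move=> Ucs; elim: w s => //= -[x p] w IHw s cw fc Is.
have cp: cls p \in cs by apply: (cw (x, p)); rewrite mem_head.
have cw': forall v, v \in w -> cls v.2 \in cs.
  by move=> v vw; apply: cw; rewrite inE vw orbT.
rewrite IHw // (bigD1_seq (cls p)) //= [RHS](bigD1_seq (cls p)) //= eqxx /=.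
rewrite mulrDl; congr +%R.
  congr *%R; apply: eq_bigr => c; rewrite eq_sym => /negPf -> //.
case Ds: (D p s) => [s'|] /=; last by rewrite !mulr0 mul0r.
have Is': I s' by apply: D_inv Ds.
rewrite IHw // (bigD1_seq (cls p)) //= mulrA; congr *%R.
apply: eq_bigr => c ncp; rewrite eq_sym (negPf ncp).
by apply/esym/opw_agree => //; [apply: fc | apply: D_agree_other Ds ncp].
Qed.

End Factor.

(** * Expansion of a word into sequences of moves *)

Section Expansion.
Variables (R : comNzRingType) (S : Type) (P : eqType) (D : P -> S -> option S).

Fixpoint subs (ps : seq P) : seq (seq P) :=
  if ps is p :: ps' then subs ps' ++ map (cons p) (subs ps') else [:: [::]].

Lemma mem_subs ps qs : (qs \in subs ps) = subseq qs ps.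
Proof.
elim: ps qs => [|p ps IHps] qs /=; first by rewrite inE.
rewrite mem_cat IHps; case: qs => [|q qs] /=; first by rewrite sub0seq.
case: eqP => [<-|qp].
  rewrite mem_map ?IHps; last by move=> ? ? [].
  apply/orb_idl => h; apply: subseq_trans h; exact: subseq_cons.
by rewrite orbC; case: mapP => // -[rs _ [/qp]].
Qed.

Lemma subs_uniq ps : uniq ps -> uniq (subs ps).
Proof.
elim: ps => //= p ps IHps /andP[pps ups].
rewrite cat_uniq IHps // map_inj_uniq ?IHps ?andbT //; last by move=> ? ? [].
apply/hasPn => _ /mapP[qs _ ->]; apply: contra pps.
by rewrite mem_subs => /mem_subseq; apply; rewrite mem_head.
Qed.

Fixpoint run (ps : seq P) (o : option S) : option S :=
  if ps is p :: ps' then run ps' (obind (D p) o) else o.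

Lemma run_None ps : run ps None = None.
Proof. by elim: ps. Qed.

(** Choosing one of the two terms in each factor [1 + x D_p] selects a sublist of [ps]. The state is
    an option so that passes can be composed. *)
Lemma opw_letter_sum (x : R) ps f o :
  oapp (opw D (letterw x ps) f) 0%R o =
  (\sum_(qs <- subs ps) x ^+ size qs * oapp f 0 (run qs o))%R.
Proof.
case: o => [s|]; last by rewrite big1 // => qs _; rewrite run_None mulr0.
rewrite /=; elim: ps s => [|p ps IHps] s /=; first by rewrite big_seq1 expr0 mul1r.
rewrite big_cat -(IHps s) big_map /=; congr +%R.
case: (D p s) => [s'|] /=.
  rewrite (IHps s') mulr_sumr; apply: eq_bigr => qs _.
  by rewrite exprS mulrA.
rewrite mulr0 big1 // => qs _; by rewrite run_None /= mulr0.
Qed.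

(* The i-th entry lists, in the order of removal, the moves of the i-th marked
   and unmarked letters. *)
Definition history : eqType := seq (seq P * seq P).

Definition replay (h : history) (o : option S) : option S :=
  foldr (fun vh o => run vh.1 (run vh.2 o)) o h.

Lemma replay_None h : replay h None = None.
Proof. by elim: h => //= a h ->; rewrite !run_None. Qed.

Lemma replay_cat h1 h2 o : replay (h1 ++ h2) o = replay h1 (replay h2 o).
Proof. exact: foldr_cat. Qed.

Variable ds : seq P.

Fixpoint histories (m : nat) : seq history :=
  if m is m'.+1 then
    [seq rcons h vu | h <- histories m',
                      vu <- [seq (v, u) | v <- subs ds, u <- subs (rev ds)]]
  else [:: [::]].

Lemma mem_histories m (h : history) :
  (h \in histories m) =
  (size h == m) && all (fun vu => subseq vu.1 ds && subseq vu.2 (rev ds)) h.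
Proof.
elim: m h => [|m IHm] h; first by rewrite inE; case: h.
apply/allpairsP/idP => [[[h' [v u]]]|]; first case=> /=.
  rewrite IHm => /andP[/eqP <- ah'] /allpairsP[[v' u'] [/= Hv Hu [-> ->]] ->].
  by rewrite size_rcons eqxx all_rcons /= -!mem_subs Hv Hu ah'.
case/lastP: h => // h [v u]; rewrite size_rcons eqSS all_rcons /= -!mem_subs.
move=> /and3P[sh /andP[vs us] ah]; exists (h, (v, u)); split => //=.
  by rewrite IHm sh.
by apply/allpairsP; exists (v, u).
Qed.

Lemma histories_uniq m : uniq ds -> uniq (histories m).
Proof.
move=> uds; elim: m => //= m IHm.
apply: allpairs_uniq => //.
  by apply: allpairs_uniq; rewrite ?subs_uniq ?rev_uniq // => -[? ?] [].
by move=> [h1 [v1 u1]] [h2 [v2 u2]] _ _ /= /rcons_inj [-> -> ->].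
Qed.

Lemma opw_histories (x : nat -> R) m f o :
  oapp (opw D (wordw [seq x i | i <- rev (iota 0 m)] (rev ds ++ ds)) f) 0%R o =
  (\sum_(h <- histories m)
     (\prod_(i < m)
        x i ^+ (size (nth ([::], [::]) h i).1 + size (nth ([::], [::]) h i).2))
      * oapp f 0 (replay h o))%R.
Proof.
elim: m o => [|m IHm] o; first by rewrite big_seq1 big_ord0 mul1r; case: o.
rewrite -addn1 iotaD rev_cat /= wordw_cons addn1.
have -> : oapp (opw D (letterw (x m) (rev ds ++ ds) ++
      wordw [seq x i | i <- rev (iota 0 m)] (rev ds ++ ds)) f) 0%R o =
    oapp (opw D (letterw (x m) (rev ds)) (opw D (letterw (x m) ds)
      (opw D (wordw [seq x i | i <- rev (iota 0 m)] (rev ds ++ ds)) f))) 0%R o.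
  by case: o => //= s; rewrite opw_cat opw_letter_cat.
(* The word acts with the last letter first, its unmarked pass before its marked one; the two
   exchanges bring the sums over these moves outside in that order. *)
rewrite opw_letter_sum big_allpairs_dep exchange_big big_allpairs_dep exchange_big /=.
apply: eq_bigr => u _; rewrite opw_letter_sum mulr_sumr; apply: eq_bigr => v _.
rewrite IHm !mulr_sumr; apply: eq_big_seq => h.
rewrite mem_histories => /andP[/eqP sh _].
rewrite /replay foldr_rcons /= big_ord_recr /= nth_rcons sh ltnn eqxx /= exprD.
under [in RHS]eq_bigr => i _ do rewrite nth_rcons sh ltn_ord.
by rewrite !mulrA; congr (_ * _)%R; ring.
Qed.

End Expansion.

(** * Beads and shapes *)

Implicit Types A B : {fset nat}.

(** For [d > 0] this is the number of cells of the shape on the diagonal [d], since a row meets the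
    diagonals from 1 to its length once each. Shapes and ribbons are compared through these
    numbers. *)
Definition cnt (d : nat) (A : {fset nat}) : nat := #|` [fset p in A | d <= p]|.

Lemma cntD1 d p A : cnt d A = cnt d (A `\ p) + ((p \in A) && (d <= p)).
Proof.
rewrite /cnt (cardfsD1 p) addnC !inE /=; congr (_ + _).
by congr #|` _|; apply/fsetP => q; rewrite !inE andbA.
Qed.

Lemma cntU1 d p A : p \notin A -> cnt d (p |` A) = cnt d A + (d <= p).
Proof.
move=> pA; rewrite (cntD1 _ p) !inE eqxx /=; congr (cnt d _ + _).
by apply/fsetP => q; rewrite !inE; case: eqP => // ->; rewrite (negPf pA).
Qed.

Lemma cntS d A : cnt d A = cnt d.+1 A + (d \in A).
Proof.
rewrite (cntD1 _ d) leqnn andbT; congr (_ + _).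
rewrite [RHS](cntD1 _ d) ltnn andbF addn0 /cnt; congr (#|` _|).
by apply/fsetP => q; rewrite !inE /=; case: eqP => //= qd; rewrite ltn_neqAle eq_sym; case: eqP.
Qed.

Lemma cnt_sub d e A : cnt d A <= cnt (d + e) A + e.
Proof.
elim: e => [|e IHe]; first by rewrite !addn0.
by move: IHe; rewrite (cntS (d + e)) !addnS; case: (_ \in A) => /=; lia.
Qed.

Lemma cnt_le d e A : d <= e -> cnt e A <= cnt d A.
Proof.
move=> de; apply/fsubset_leq_card/fsubsetP => p; rewrite !inE /= => /andP[-> /=].
exact: leq_trans.
Qed.

Lemma cnt_le_sub d e A : d <= e -> cnt d A <= cnt e A + (e - d).
Proof. by move=> de; have := cnt_sub d (e - d) A; rewrite subnKC. Qed.

Lemma cnt_eq A B : 0 \notin A -> 0 \notin B ->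
  (forall d, 0 < d -> cnt d A = cnt d B) -> A = B.
Proof.
move=> A0 B0 AB; apply/fsetP => -[|p]; first by rewrite (negPf A0) (negPf B0).
have := AB p.+1 isT; rewrite (cntS p.+1) (cntS p.+1 B) AB // => /addnI.
by case: (_ \in A); case: (_ \in B).
Qed.

Lemma cnt_enum d (A : {fset nat}) : cnt d A = count (leq d) A.
Proof.
rewrite /cnt -size_filter.
apply/perm_size/uniq_perm; rewrite ?filter_uniq ?fset_uniq // => p.
by rewrite !inE mem_filter /= andbC.
Qed.

Lemma nth_count_leq (la : seq nat) i d : sorted gtn la -> 0 < d ->
  (d <= nth 0 la i) = (i < count (leq d) la).
Proof.
move=> sla d0; elim: la i sla => [|p la IHla] [|i] //= sla.
- by rewrite leqNgt d0.
- by rewrite leqNgt d0.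
- case: (leqP d p) => //= pd; rewrite lt0n; symmetry; apply/negbTE; rewrite negbK.
  rewrite -leqn0 leqNgt -has_count; apply/hasPn => q /(allP (order_path_min _ sla)) /=.
  by move=> h; rewrite -ltnNge; apply: ltn_trans pd; apply: h => a b c; lia.
rewrite IHla ?(path_sorted sla) //; case: (leqP d p) => //= pd.
rewrite add0n; apply/idP/idP => [h|h]; last by lia.
suff: count (leq d) la = 0 by lia.
apply/eqP; rewrite -leqn0 leqNgt -has_count; apply/hasPn => q.
move=> /(allP (order_path_min _ sla)) /= qp.
by rewrite -ltnNge; apply: ltn_trans pd; apply: qp => a b c; lia.
Qed.

Lemma mem_shdiag la c r : sorted gtn la ->
  ((c, r) \in shdiag la) = [&& 0 < r, r <= c & r <= count (leq (c - r + 1)) la].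
Proof.
move=> sla; rewrite inE /=; apply/allpairsPdep/and3P => /=.
  move=> [r' [c' []]]; rewrite !mem_iota => /andP[r0 rs] cr [-> ->].
  have: c' - r' + 1 <= nth 0 la r'.-1 by lia.
  by rewrite nth_count_leq //; [split; lia | lia].
move=> [r0 rc]; rewrite -{1}(prednK r0) -nth_count_leq //; last by lia.
move=> h; exists r, c; rewrite !mem_iota; split=> //; last by lia.
by case: (ltnP r.-1 (size la)) => [|l]; [lia | move: h; rewrite nth_default //; lia].
Qed.

(* Locked, so that inE does not unfold membership in a shape. *)
Definition sh (A : {fset nat}) : diagram := locked (shdiag (sort geq A)).

Lemma shE A : sh A = shdiag (sort geq A).
Proof. by rewrite /sh -lock. Qed.

Lemma sort_fset_sorted (A : {fset nat}) : sorted gtn (sort geq A).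
Proof.
have h: sorted geq (sort geq A) by apply: sort_sorted => a b; exact: leq_total.
have: uniq (sort geq A) by rewrite sort_uniq fset_uniq.
elim: (sort geq A) h => //= a l IHl pl /andP[al ul].
have {}IHl := IHl (path_sorted pl) ul.
case: l al IHl pl {ul} => //= b l; rewrite inE negb_or => /andP[ab _] -> /andP[ba _].
by rewrite andbT ltn_neqAle eq_sym ab.
Qed.

Lemma mem_sh A c r :
  ((c, r) \in sh A) = [&& 0 < r, r <= c & r <= cnt (c - r + 1) A].
Proof.
rewrite shE mem_shdiag ?sort_fset_sorted // cnt_enum; congr [&& _, _ & _ <= _].
by apply/permP; rewrite perm_sort.
Qed.

Lemma mem_sh_diag A d r : 0 < d -> 0 < r -> ((r + d - 1, r) \in sh A) = (r <= cnt d A).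
Proof.
move=> d0 r0; rewrite mem_sh r0 /=; have -> : r <= r + d - 1 by lia.
by have -> : r + d - 1 - r + 1 = d by lia.
Qed.

Definition seq_fsetn (la : seq nat) : {fset nat} := [fset x in la].

Lemma seq_fsetnE la x : (x \in seq_fsetn la) = (x \in la).
Proof. by rewrite inE. Qed.

Lemma gtn_sorted_uniq la : sorted gtn la -> uniq la.
Proof. by apply: sorted_uniq => [a b c|a] /=; lia. Qed.

Lemma sort_seq_fsetn la : sorted gtn la -> sort geq (seq_fsetn la) = la.
Proof.
move=> sla; apply: (irr_sorted_eq (leT := gtn)) => //.
- by move=> a b c /=; lia.
- by move=> a /=; lia.
- exact: sort_fset_sorted.
by move=> x; rewrite mem_sort seq_fsetnE.
Qed.

Lemma shdiag_sh la : sorted gtn la -> shdiag la = sh (seq_fsetn la).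
Proof. by move=> sla; rewrite shE sort_seq_fsetn. Qed.

Lemma is_shiftedP D : is_shifted D <-> exists2 A, 0 \notin A & D = sh A.
Proof.
split=> [[la /andP[sla la0] ->]|[A A0 ->]].
  by exists (seq_fsetn la); rewrite ?seq_fsetnE // shdiag_sh.
by exists (sort geq A); rewrite ?shE // /strict_partition sort_fset_sorted mem_sort.
Qed.

Lemma sh_shifted A : 0 \notin A -> is_shifted (sh A).
Proof. by move=> A0; apply/is_shiftedP; exists A. Qed.

Lemma sh_sub A B : (forall d, 0 < d -> cnt d A <= cnt d B) -> sh A `<=` sh B.
Proof.
move=> AB; apply/fsubsetP => -[c r]; rewrite !mem_sh => /and3P[-> ->] /= h.
by apply: leq_trans h _; apply: AB; lia.
Qed.

Lemma sh_subE A B d : sh A `<=` sh B -> 0 < d -> cnt d A <= cnt d B.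
Proof.
move=> /fsubsetP AB d0; case c0: (cnt d A) => [//|n].
by rewrite -mem_sh_diag //; apply: AB; rewrite mem_sh_diag // c0.
Qed.

Lemma sh_inj A B : 0 \notin A -> 0 \notin B -> sh A = sh B -> A = B.
Proof.
move=> A0 B0 AB; apply: cnt_eq => // d d0.
by apply/eqP; rewrite eqn_leq !sh_subE // ?AB ?fsubset_refl // -AB fsubset_refl.
Qed.

Lemma cellE (D : diagram) x A : D `<=` sh A -> x \in D ->
  [/\ 0 < x.2, 0 < diag x & x = (x.2 + diag x - 1, x.2)].
Proof.
move=> /fsubsetP DA /DA; case: x => c r; rewrite mem_sh /diag /= => /and3P[r0 rc _].
by split => //; [lia | congr pair; lia].
Qed.

(* The ribbon of length k with head on the diagonal p covers the diagonals
   p-k+1, ..., p and, if it is double, moreover 1, ..., k-p. *)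
Definition ribbon_cells (k p d : nat) : nat := ((d <= p) && (p < d + k)) + (d + p <= k).

(** The condition [k < p.*2] makes [p] the larger of the two deleted beads, so that a double ribbon
    arises from one position only. For [p == k] the bead would land on 0, which is not a part, and
    disappears. *)
Definition mv (k p : nat) (A : {fset nat}) : option {fset nat} :=
  if p \notin A then None
  else if p < k then
    if (k < p.*2) && (k - p \in A) then Some (A `\ p `\ (k - p)) else None
  else if p == k then Some (A `\ k)
  else if p - k \in A then None else Some ((p - k) |` (A `\ p)).

Lemma mv_cnt k p A B : 0 < k -> mv k p A = Some B -> 
  k < p.*2 /\ forall d, 0 < d -> cnt d A = cnt d B + ribbon_cells k p d.
Proof.
move=> k0; rewrite /mv /ribbon_cells; case: ifPn => // /negPn pA.
case: ltnP => pk.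
  case: ifP => // /andP[kp qA] [<-]; split=> // d d0.
  rewrite (cntD1 _ p) pA (cntD1 _ (k - p)) !inE qA.
  by have -> /= : k - p != p; lia.
case: eqP => [pk'|npk].
  case=> <-; rewrite -pk' in k0 *; split; first lia.
  by move=> d d0; rewrite (cntD1 _ p) pA; lia.
case: ifPn => // qA [<-]; split; first lia.
move=> d d0; rewrite (cntD1 _ p) pA cntU1 ?inE; last by rewrite (negPf qA) andbF.
by lia.
Qed.

Lemma mv0 k p A B : 0 < k -> mv k p A = Some B -> 0 \notin A -> 0 \notin B.
Proof.
move=> k0; rewrite /mv; case: ifP => // _.
case: ltnP => pk.
  by case: ifP => // _ [<-] A0; rewrite !inE (negPf A0) !andbF.
case: eqP => [_ [<-] A0|npk]; first by rewrite !inE (negPf A0) !andbF.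
case: ifP => // _ [<-] A0; rewrite !inE (negPf A0) !andbF orbF; lia.
Qed.

Lemma mem_of_cnt k p A B : (forall d, 0 < d -> cnt d A = cnt d B + ribbon_cells k p d) ->
  forall d, 0 < d ->
    (d \in A) + ribbon_cells k p d.+1 = (d \in B) + ribbon_cells k p d.
Proof.
move=> AB d d0; have := AB d d0; rewrite (cntS d A) (cntS d B) AB //.
by move: (ribbon_cells k p d) (ribbon_cells k p d.+1); lia.
Qed.

(** Differences of consecutive counts give the membership of each bead ([mem_of_cnt]). So beads
    change only where the number of covered diagonals jumps, at [p] and at [p - k] or [k - p]. *)
Lemma cnt_mv k p A B : 0 < k -> 0 \notin A -> 0 \notin B -> k < p.*2 ->
  (forall d, 0 < d -> cnt d A = cnt d B + ribbon_cells k p d) -> mv k p A = Some B.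
Proof.
move=> k0 A0 B0 kp AB.
have mem := mem_of_cnt AB; have p0 : 0 < p by lia.
have pA : p \in A by have := mem p p0; rewrite /ribbon_cells; lia.
have pB : p \notin B by have := mem p p0; rewrite /ribbon_cells pA; lia.
have E d : d != p -> (p < k -> d != k - p) -> (k < p -> d != p - k) ->
    (d \in B) = (d \in A).
  move=> dp d1 d2; case: (posnP d) => [->|d0]; first by rewrite (negPf A0) (negPf B0).
  have := mem d d0; rewrite /ribbon_cells.
  by case: (d \in A); case: (d \in B) => /=; lia.
rewrite /mv pA /=; case: ltnP => pk.
  have := mem (k - p); rewrite /ribbon_cells kp => qAB.
  have qA : k - p \in A by lia.
  have qB : k - p \notin B by lia.
  rewrite qA; congr Some; apply/fsetP => d; rewrite !inE.
  case: (eqVneq d (k - p)) => [->|dq] /=; first by rewrite (negPf qB).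
  case: (eqVneq d p) => [->|dp] /=; first by rewrite (negPf pB).
  by rewrite E //; lia.
case: eqP => [pk'|npk].
  congr Some; apply/fsetP => d; rewrite !inE -pk'.
  case: (eqVneq d p) => [->|dp] /=; first by rewrite (negPf pB).
  by rewrite E //; lia.
have := mem (p - k); rewrite /ribbon_cells => qAB.
have qA : p - k \notin A by lia.
have qB : p - k \in B by lia.
rewrite (negPf qA); congr Some; apply/fsetP => d; rewrite !inE.
case: (eqVneq d (p - k)) => [->|dq] /=; first by rewrite qB.
case: (eqVneq d p) => [->|dp] /=; first by rewrite (negPf pB).
by rewrite E //; lia.
Qed.

Lemma mv_head k p A B : 0 < k -> mv k p A = Some B ->
  [/\ p \in A, p \notin B & cnt p A = (cnt p B).+1].
Proof.
move=> k0 m; have [kp AB] := mv_cnt k0 m; have p0 : 0 < p by lia.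
have := AB p p0; have := mem_of_cnt AB p0; rewrite /ribbon_cells => h1 h2.
by split; lia.
Qed.

Lemma mv_inj k p q A B : 0 < k -> mv k p A = Some B -> mv k q A = Some B -> p = q.
Proof.
move=> k0 mp mq; have [kp /[dup] /mem_of_cnt ABp _] := mv_cnt k0 mp.
have [kq AB] := mv_cnt k0 mq.
have [pA pB _] := mv_head k0 mp; have [qA qB _] := mv_head k0 mq.
have := ABp q; have := mem_of_cnt AB (d := p); rewrite /ribbon_cells pA qA (negPf pB) (negPf qB).
by lia.
Qed.

Lemma mv_bound k p A B N : 0 < k -> mv k p A = Some B ->
  (forall q, q \in A -> q <= N) -> (forall q, q \in B -> q <= N).
Proof.
move=> k0 m AN q; have [pA _ _] := mv_head k0 m; have pN := AN _ pA.
move: m; rewrite /mv pA /=; case: ltnP => pk.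
  by case: ifP => // _ [<-]; rewrite !inE => /and3P[_ _ /AN].
case: eqP => [_ [<-]|_]; first by rewrite !inE => /andP[_ /AN].
by case: ifP => // _ [<-]; rewrite !inE => /orP[/eqP->|/andP[_ /AN//]]; lia.
Qed.

(** * Ribbons *)

Definition ndiag (D : diagram) (d : nat) : nat := #|` [fset x in D | diag x == d]|.

Lemma ndiagU D E d : [disjoint D & E] -> ndiag (D `|` E) d = ndiag D d + ndiag E d.
Proof.
move=> DE; rewrite /ndiag -cardfsUI.
set F := _ `&` _; have -> : F = fset0.
  apply/fsetP => x; rewrite !inE /=; apply/negbTE; apply/negP => /and3P[/andP[xD _] xE _].
  by move/fdisjointP/(_ _ xD): DE; rewrite xE.
rewrite cardfs0 addn0; congr #|` _|; apply/fsetP => x; rewrite !inE /=.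
by rewrite andb_orl.
Qed.

Lemma ndiag_sh A d : 0 < d -> ndiag (sh A) d = cnt d A.
Proof.
move=> d0; rewrite /ndiag.
have -> : [fset x in sh A | diag x == d] =
    [fset ((r + d - 1, r) : cell) | r in iota 1 (cnt d A)].
  apply/fsetP => -[c r]; rewrite !inE /= mem_sh /diag /=.
  apply/andP/imfsetP => /= [[/and3P[r0 rc rA] /eqP cd]|[r']].
    by exists r; [rewrite mem_iota -cd; lia | congr pair; lia].
  rewrite mem_iota => h [-> ->]; have -> : r' + d - 1 - r' + 1 = d by lia.
  by split=> //; apply/and3P; split; lia.
rewrite card_imfset /=; last by move=> r r' [].
by rewrite undup_id ?iota_uniq // size_iota.
Qed.

Lemma cnt_ribbon A B U : sh A `\` U = sh B -> U `<=` sh A ->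
  forall d, 0 < d -> cnt d A = cnt d B + ndiag U d.
Proof.
move=> UB UA d d0; rewrite -!ndiag_sh // -UB -ndiagU; first by rewrite fsetUC fsetUDl fsetDv fsetD0 (fsetUidPr _ _ UA).
by apply/fdisjointP => x; rewrite inE => /andP[].
Qed.

Lemma single_ribbon_diags A R h : R `<=` sh A -> single_ribbon R -> is_head R h ->
  exists t, [/\ 0 < t <= diag h, #|` R| = (diag h).+1 - t,
    exists2 x, is_tail R x & diag x = t &
    forall d, ndiag R d = (t <= d <= diag h)].
Proof.
move=> RA [R0 conn _ dinj] [hR hmax].
(* [diag] is a truncated subtraction; it is faithful on cells whose row is at most their column. *)
have cells x : x \in R -> 0 < x.2 /\ x.2 <= x.1.
  by move=> /(fsubsetP RA); case: x => c r; rewrite mem_sh => /and3P[].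
pose T := [arg min_(x < [` hR]) diag (val x)].
have Tmin x : x \in R -> diag (val T) <= diag x.
  by rewrite /T; case: arg_minnP => //= i _ mini xR; apply: (mini [` xR]).
have convex d : diag (val T) <= d <= diag h -> exists2 x, x \in R & diag x = d.
  move=> dTh; apply: contrapT => nod.
  have nd x : x \in R -> diag x != d by move=> xR; apply/eqP => xd; apply: nod; exists x.
  (* Adjacent cells lie on consecutive diagonals, so a path from the tail to the head cannot jump
     over a missing diagonal [d]. *)
  have cl : closed (fun a b : R => adjacent (val a) (val b)) (fun x : R => diag (val x) < d).
    move=> x y; rewrite !unfold_in /adjacent.
    move: (nd _ (valP x)) (nd _ (valP y)) (cells _ (valP x)) (cells _ (valP y)).
    by rewrite /diag; move: (val x) (val y) => [c r] [c' r'] /=; lia.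
  move: (closed_connect cl (conn T [` hR])) (nd _ (valP T)) (nd _ hR) dTh.
  by rewrite !unfold_in /=; lia.
have nd1 d : ndiag R d = (diag (val T) <= d <= diag h).
  have le1 : ndiag R d <= 1.
    rewrite /ndiag; case: (fset_0Vmem [fset x in R | diag x == d]) => [->|[x]]; first by rewrite cardfs0.
    rewrite !inE /= => /andP[xR /eqP xd]; rewrite -(cardfs1 x).
    apply/fsubset_leq_card/fsubsetP => y; rewrite !inE /= => /andP[yR /eqP yd].
    by apply/eqP/dinj; rewrite // xd yd.
  have : (0 < ndiag R d) = (diag (val T) <= d <= diag h).
    apply/idP/idP.
      rewrite /ndiag cardfs_gt0 => /fset0Pn [x]; rewrite !inE /= => /andP[xR /eqP <-].
      by rewrite Tmin // hmax.
    move=> /convex [x xR xd]; rewrite /ndiag cardfs_gt0; apply/fset0Pn; exists x.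
    by rewrite !inE /= xR xd eqxx.
  by case: (diag (val T) <= d <= diag h); lia.
exists (diag (val T)); split=> //.
- by rewrite Tmin // andbT /diag addn1.
- have <- : #|` [fset diag x | x in R]| = #|` R| by rewrite card_in_imfset.
  have -> : [fset diag x | x in R] = [fset d in iota (diag (val T)) ((diag h).+1 - diag (val T))].
    apply/fsetP => d; rewrite !inE /= mem_iota; have Th := Tmin _ hR.
    apply/imfsetP/idP => /= [[x xR ->]|h']; first by move: (Tmin _ xR) (hmax _ xR) Th => /=; lia.
    have [|x xR xd] := convex d; first by move: h' Th => /=; lia.
    by exists x.
  by rewrite card_imfset //= undup_id ?iota_uniq // size_iota.
- by exists (val T) => //; split=> [|x]; [exact: valP | exact: Tmin].
Qed.

Lemma mem_skew A B c r : ((c, r) \in sh A `\` sh B) =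
  [&& 0 < r, r <= c, r <= cnt (c - r + 1) A & cnt (c - r + 1) B < r].
Proof.
rewrite inE !mem_sh; case: (posnP r) => r0 //=.
by case: (leqP r c) => rc /=; rewrite ?andbF // -ltnNge andbC.
Qed.

(** The difference consists of the topmost cell of [sh A] on each of the diagonals from [t] to [p].
    Topmost cells of consecutive diagonals are adjacent because [cnt d A] drops by at most 1 when
    [d] grows by 1. *)
Lemma diff_is_single_ribbon A B t p : 0 \notin A -> 0 \notin B -> 0 < t <= p ->
    (forall d, 0 < d -> cnt d A = cnt d B + (t <= d <= p)) ->
  [/\ single_ribbon (sh A `\` sh B), is_head (sh A `\` sh B) (cnt p A + p - 1, cnt p A),
      is_tail (sh A `\` sh B) (cnt t A + t - 1, cnt t A) &
      #|` sh A `\` sh B| = p.+1 - t].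
Proof.
move=> A0 B0 tp AB.
pose top d : cell := (cnt d A + d - 1, cnt d A).
have memR x : x \in sh A `\` sh B -> t <= diag x <= p /\ x = top (diag x).
  case: x => c r; rewrite mem_skew /diag /top /= => /and4P[r0 rc rA rB].
  have d0 : 0 < c - r + 1 by lia.
  have ABr := AB _ d0; split; first by lia.
  by congr pair; lia.
have topR d : t <= d <= p -> top d \in sh A `\` sh B /\ diag (top d) = d.
  move=> dp; have := AB d; rewrite mem_skew /diag /=.
  have -> : cnt d A + d - 1 - cnt d A + 1 = d by lia.
  by lia.
have topRd d (dp : t <= d <= p) := (topR d dp).1.
have single : single_ribbon (sh A `\` sh B).
  split.
  - by apply/fset0Pn; exists (top t); apply: topRd; lia.
  - pose e (a b : sh A `\` sh B) := adjacent (val a) (val b).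
    have esym : connect_sym e.
      apply: sym_connect_sym => a b; rewrite /e /adjacent.
      by congr orb; rewrite eq_sym (orbC (_ == _)).
    have tt : t <= t <= p by lia.
    have con i (dp : t <= t + i <= p) : connect e [` topRd t tt] [` topRd _ dp].
      elim: i dp => [|i IHi] dp.
        by have -> : [` topRd _ dp] = [` topRd t tt] by apply: val_inj; rewrite /= addn0.
      have dp' : t <= t + i <= p by lia.
      apply: connect_trans (IHi dp') _; apply: connect1; rewrite /e /adjacent /top /=.
      by have := cntS (t + i) A; rewrite addnS; case: (_ \in A) => /=; lia.
    have conx (x : sh A `\` sh B) : connect e [` topRd t tt] x.
      have [xd xt] := memR _ (valP x).
      have xd' : t <= t + (diag (val x) - t) <= p by lia.
      have -> : x = [` topRd _ xd'] by apply: val_inj; rewrite /= subnKC //; case/andP: xd.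
      exact: con.
    by move=> x y; apply: connect_trans (conx y); rewrite -/e esym.
  - exists (sh A), (sh B); split=> //; [exact: (sh_shifted A0) | exact: (sh_shifted B0) |].
    by apply: sh_sub => d /AB ->; lia.
  - by move=> x y /memR [_ xt] /memR [_ yt] xy; rewrite xt yt xy.
have hd : is_head (sh A `\` sh B) (top p).
  have [|pR pd] := topR p; first by lia.
  by split=> // x /memR [xd _]; rewrite pd; lia.
split=> //.
- have [|tR td] := topR t; first by lia.
  by split=> // x /memR [xd _]; rewrite td; lia.
have [t' [t'p -> _ nd]] := single_ribbon_diags (fsubsetDl _ _) single hd.
have [|_ pd] := topR p; first by lia.
rewrite pd in t'p nd *; suff -> : t' = t by [].
have UB : sh A `\` (sh A `\` sh B) = sh B.
  by apply/fsetDK/sh_sub => d /AB ->; lia.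
have := cnt_ribbon UB (fsubsetDl _ _).
move=> E; have := E t; have := E t'; have := AB t; have := AB t'; rewrite !nd; lia.
Qed.

(** Only the number of cells on each diagonal matters: it is [ribbon_cells], and [cnt_mv] recovers
    the move. In a double ribbon both tails lie on the diagonal 1, so each arm covers all diagonals
    up to its head. The head is then the only cell of the difference on the diagonal [p]. *)
Lemma kribbon_mv k A U h : 0 < k -> 0 \notin A -> removable (sh A) U ->
    kribbon_with_head k (sh A) U h ->
  exists p B, [/\ mv k p A = Some B, U = sh A `\` sh B &
                 h = (cnt p A + p - 1, cnt p A)].
Proof.
move=> k0 A0 [_ UA /is_shiftedP [B B0 UB]] [Uk kh].
have AB := cnt_ribbon UB UA.
have EU : U = sh A `\` sh B by rewrite -UB fsetDK.
suff [p [hU hp kp nd]] : exists p, [/\ h \in U, diag h = p, k < p.*2 &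
    forall d, 0 < d -> ndiag U d = ribbon_cells k p d].
  have AB' d : 0 < d -> cnt d A = cnt d B + ribbon_cells k p d.
    by move=> d0; rewrite AB // nd.
  have m := cnt_mv k0 A0 B0 kp AB'.
  exists p, B; split=> //.
  have [h2 hd hE] := cellE UA hU; have [_ _ pAB] := mv_head k0 m.
  move: hU; rewrite hE EU mem_skew hp; have -> : h.2 + p - 1 - h.2 + 1 = p by lia.
  by move=> /and4P[_ _ hA hB]; congr pair; lia.
case: kh => [[_ sU hU]|[R [S [[[sR sS RS RSA cSR] [[tR tRt tRm] [tS tSt tSm] _]] URS hR]]]].
  have [t [tp Ut _ nd]] := single_ribbon_diags UA sU hU.
  exists (diag h); split=> //; first by case: hU.
    by rewrite -Uk Ut; lia.
  by move=> d d0; rewrite nd /ribbon_cells -Uk Ut; lia.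
have [RA SA] : R `<=` sh A /\ S `<=` sh A.
  by split; apply: fsubset_trans RSA; [apply: fsubsetUl|apply: fsubsetUr].
have [t [tp Rt [x [xR xmin] xt] ndR]] := single_ribbon_diags RA sR hR.
have [hS hSP] : exists hS, is_head S hS.
  case: sS => /fset0Pn [y yS] _ _ _.
  exists (val [arg max_(z > [` yS]) diag (val z)]).
  case: arg_maxnP => //= z _ zmax; split; first exact: valP.
  by move=> w wS; apply: (zmax [` wS]).
have [u [up Su [y [yS ymin] yu] ndS]] := single_ribbon_diags SA sS hSP.
have t1 : t = 1.
  move: tRm tRt; rewrite !inE /= => /andP[_ /eqP td] [tRR tmin].
  by move: (tmin _ xR) (xmin _ tRR) tp; rewrite xt td; clear; lia.
have u1 : u = 1.
  move: tSm tSt; rewrite !inE /= => /andP[_ /eqP td] [tSS tmin].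
  by move: (tmin _ yS) (ymin _ tSS) up; rewrite yu td; clear; lia.
have kE : k = diag h + diag hS.
  rewrite -Uk URS.
  have := cardfsUI R S; rewrite (eqP (_ : R `&` S == fset0)) ?cardfs0 ?Rt ?Su ?t1 ?u1; first by clear; lia.
  by move: RS; rewrite -fsetI_eq0.
have nd d : 0 < d -> ndiag U d = (d <= diag h) + (d <= diag hS).
  by move=> d0; rewrite URS ndiagU // ndR ndS t1 u1 d0.
have hh : diag hS <= diag h by move: cSR tp up; rewrite Rt Su t1 u1; clear; lia.
(* Arms of equal length would lower the count by 2 on their last diagonal and by 0 on the next,
   while membership of a single bead accounts for at most 1. *)
have hne : diag hS != diag h.
  apply/eqP => E; have h0 : 0 < diag h by rewrite /diag addn1.
  have := AB (diag h) h0; have := AB (diag h).+1 isT.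
  rewrite !nd // E (cntS (diag h) A) (cntS (diag h) B).
  move: (_ \in A) (_ \in B) (cnt _ A) (cnt _ B) => [] []; clear; lia.
exists (diag h); split=> //; first by rewrite URS inE; case: hR => ->.
  by move: hh hne kE; clear; lia.
by move=> d d0; rewrite nd // /ribbon_cells kE; move: d0 hh hne; clear; lia.
Qed.

Lemma mv_kribbon k p A B : 0 < k -> 0 \notin A -> mv k p A = Some B ->
  [/\ sh B `<=` sh A, removable (sh A) (sh A `\` sh B) &
     kribbon_with_head k (sh A) (sh A `\` sh B) (cnt p A + p - 1, cnt p A)].
Proof.
move=> k0 A0 m; have [kp AB] := mv_cnt k0 m; have B0 := mv0 k0 m A0.
have BA : sh B `<=` sh A by apply: sh_sub => d /AB ->; lia.
have UB : sh A `\` (sh A `\` sh B) = sh B by apply: fsetDK.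
split=> //.
  by split; rewrite ?fsubsetDl ?UB //; apply: sh_shifted.
case: (leqP k p) => pk.
  have [||sU hU tU cU] := diff_is_single_ribbon (t := p.+1 - k) (p := p) A0 B0; first lia.
    by move=> d d0; rewrite AB // /ribbon_cells; lia.
  by split; [rewrite cU; lia | left; split=> //; exact: fsubsetDl].
move: (m); rewrite /mv; case: ifP => // /negbFE pA; rewrite pk; case: ifP => // /andP[_ qA] [BE].
(* Deleting the bead [p] alone removes the longer arm; deleting [k - p] afterwards removes the
   shorter one. *)
set C := A `\ p.
have C0 : 0 \notin C by rewrite !inE (negPf A0) andbF.
have AC d : 0 < d -> cnt d A = cnt d C + (1 <= d <= p).
  by move=> d0; rewrite (cntD1 d p) pA d0.
have CB d : 0 < d -> cnt d C = cnt d B + (1 <= d <= k - p).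
  move=> d0; have := AC d d0; rewrite AB // /ribbon_cells; lia.
have [|sR hR tR cR] := diff_is_single_ribbon (t := 1) A0 C0 _ AC; first lia.
have [|sS hS tS cS] := diff_is_single_ribbon (t := 1) C0 B0 _ CB; first lia.
have BC : sh B `<=` sh C by apply: sh_sub => d /CB ->; lia.
have CA : sh C `<=` sh A by apply: sh_sub => d /AC ->; lia.
have disj : [disjoint sh A `\` sh C & sh C `\` sh B].
  by apply/fdisjointP => x; rewrite !inE => /andP[/negPf -> _]; rewrite andbF.
have EU : sh A `\` sh B = (sh A `\` sh C) `|` (sh C `\` sh B).
  apply/fsetP => x; rewrite !inE.
  have := fsubsetP BC x; have := fsubsetP CA x.
  by case: (x \in sh A); case: (x \in sh B); case: (x \in sh C) => // a b; first [by have := a isT | by have := b isT].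
have cU : #|` sh A `\` sh B| = k.
  have := cardfsUI (sh A `\` sh C) (sh C `\` sh B).
  by rewrite -EU (eqP (_ : _ `&` _ == fset0)) ?fsetI_eq0 // cardfs0 cR cS; lia.
split=> //; right; exists (sh A `\` sh C), (sh C `\` sh B); split=> //.
split; first by split=> //; rewrite -?EU ?fsubsetDl // cR cS; lia.
split.
- exists (cnt 1 A + 1 - 1, cnt 1 A) => //; case: tR => tR _.
  by rewrite !inE /= (fsubsetP (fsubsetDl _ _) _ tR) /diag /=; lia.
- exists (cnt 1 C + 1 - 1, cnt 1 C) => //; case: tS => tS _.
  have AC' : sh A `\` (sh A `\` sh C) = sh C by apply: fsetDK.
  by rewrite AC' !inE /= (fsubsetP (fsubsetDl _ _) _ tS) /diag /=; lia.
by rewrite -EU; exists (sh A), (sh B); split=> //; [exact: (sh_shifted A0)|exact: (sh_shifted B0)].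
Qed.

(** [cnt d B + d] is weakly increasing in [d], and [cnt p A] exceeds [cnt p B] by 1. For [p < q] the
    opposite inequality gains the missing 1 from [p \notin B], where [cnt] does not drop. *)
Lemma horizontal_heads k p q A B C : 0 < k -> 0 \notin A ->
    mv k p A = Some B -> mv k q B = Some C ->
  (cnt q B + q - 1 < cnt p A + p - 1) = (q < p).
Proof.
move=> k0 A0 mA mB; have [pA pB pAB] := mv_head k0 mA; have [qB qC qBC] := mv_head k0 mB.
have [kp _] := mv_cnt k0 mA; have [kq _] := mv_cnt k0 mB.
case: (ltngtP q p) => [qp|pq|E]; last by rewrite -E qB in pB.
  by have := cnt_le_sub B (ltnW qp); lia.
by have := cntS p B; rewrite (negPf pB); have := cnt_le_sub B pq; lia.
Qed.

(** [cnt d B] is weakly decreasing in [d], and [cnt p A] exceeds [cnt p B] by 1. For [q < p] the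
    opposite inequality gains the missing 1 from [q \in B], where [cnt] drops. *)
Lemma vertical_heads k p q A B C : 0 < k -> 0 \notin A ->
    mv k p A = Some B -> mv k q B = Some C ->
  (cnt q B < cnt p A) = (p < q).
Proof.
move=> k0 A0 mA mB; have [pA pB pAB] := mv_head k0 mA; have [qB qC qBC] := mv_head k0 mB.
case: (ltngtP p q) => [pq|qp|E]; last by rewrite E qB in pB.
  by have := cnt_le B (ltnW pq); lia.
by have := cntS q B; rewrite qB; have := cnt_le B qp; lia.
Qed.

(** * Strips *)

Lemma ribbon_strip_nil before k D0 D : ribbon_strip before k D0 [::] D <-> D0 = D.
Proof.
split=> [[]|->] //; split=> // i; rewrite /= leqn0 => /andP[h /eqP i0].
  by rewrite i0 in h.
by rewrite i0 in h.
Qed.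

Lemma ribbon_strip_rcons before k D0 c E D :
  ribbon_strip before k D0 (rcons c E) D <->
  [/\ E = D, ribbon_strip before k D0 c (last D0 c),
      [/\ last D0 c `<=` D, removable D (D `\` last D0 c) &
          kribbon k D (D `\` last D0 c)] &
      forall c' F, c = rcons c' F -> exists h' h,
        [/\ kribbon_with_head k F (F `\` last D0 c') h',
            kribbon_with_head k D (D `\` F) h & before h' h]].
Proof.
have nthl i : i <= size c -> nth fset0 (D0 :: rcons c E) i = nth fset0 (D0 :: c) i.
  by rewrite -rcons_cons nth_rcons /= ltnS => ->.
have nthE : nth fset0 (D0 :: rcons c E) (size c).+1 = E.
  by rewrite -rcons_cons nth_rcons /= ltnn eqxx.
have nthc : nth fset0 (D0 :: c) (size c) = last D0 c by rewrite -last_nth.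
split.
  case; rewrite last_rcons size_rcons => <- ribs heads; split=> //.
  - split=> // i /andP[i0 ic].
      have := ribs i; rewrite !nthl ?ic ?(leq_trans (leq_pred i) ic) //.
      by rewrite i0 (leq_trans ic (leqnSn _)); apply.
    have := heads i; rewrite !nthl ?ic ?(leq_trans (leq_pred _) ic) //; last first.
      by apply: leq_trans ic; apply: leq_trans (leq_pred _) (leq_pred _).
    by rewrite i0 (leq_trans ic (leqnSn _)); apply.
  - by have := ribs (size c).+1; rewrite nthE nthl //= nthc; apply; rewrite !leqnn.
  - move=> c' F cF; have := heads (size c).+1.
    rewrite nthE /= nthl // nthl ?leq_pred // nthc cF size_rcons last_rcons /=.
    rewrite -rcons_cons nth_rcons /= ?ltnS leqnn -last_nth; apply.
    by [].
case=> <- [_ ribs heads] [cD rD kD] hd.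
rewrite /ribbon_strip; cbv beta zeta; split; first by rewrite last_rcons.
  move=> i /andP[i0]; rewrite size_rcons leq_eqVlt ltnS => /orP[/eqP ->|ic].
    by rewrite nthE nthl //= nthc.
  by rewrite !nthl ?ic ?(leq_trans (leq_pred i) ic) //; apply: ribs; rewrite i0.
move=> i /andP[i0]; rewrite size_rcons leq_eqVlt ltnS => /orP[/eqP ic|ic].
  rewrite ic nthE /= nthl // nthl ?leq_pred // nthc.
  case/lastP: c {nthl nthE ribs heads cD rD kD} nthc hd ic => [|c F] nthc hd ic.
    by rewrite ic in i0.
  rewrite size_rcons last_rcons /= -rcons_cons nth_rcons /= ?ltnS leqnn -last_nth.
  exact: hd.
rewrite !nthl ?ic ?(leq_trans (leq_pred i) ic) //; first by apply: heads; rewrite i0.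
by apply: leq_trans ic; apply: leq_trans (leq_pred _) (leq_pred _).
Qed.

Definition osh (o : option {fset nat}) : diagram := oapp sh fset0 o.

(** [ps] lists heads in the order of removal, from the outer shape inward, whereas a strip lists its
    shapes outward; hence [rcons]. *)
Fixpoint chain (k : nat) (ps : seq nat) (o : option {fset nat}) : seq diagram :=
  if ps is p :: ps' then rcons (chain k ps' (obind (mv k p) o)) (osh o) else [::].

Lemma size_chain k ps o : size (chain k ps o) = size ps.
Proof. by elim: ps o => //= p ps IHps o; rewrite size_rcons IHps. Qed.

Lemma last_chain k ps o B :
  run (mv k) ps o = Some B -> last (sh B) (chain k ps o) = osh o.
Proof. by case: ps => [|p ps] /=; [move=> -> | rewrite last_rcons]. Qed.

Lemma run_mv0 k ps A B : 0 < k -> 0 \notin A ->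
  run (mv k) ps (Some A) = Some B -> 0 \notin B.
Proof.
move=> k0; elim: ps A => [|p ps IHps] A A0 /=; first by case=> <-.
case m: (mv k p A) => [C|]; last by rewrite run_None.
by apply: IHps; apply: mv0 m A0.
Qed.

Lemma run_mv_bound k ps A B N : 0 < k -> 0 \notin A -> (forall q, q \in A -> q <= N) ->
  run (mv k) ps (Some A) = Some B ->
  {subset ps <= iota 1 N} /\ forall q, q \in B -> q <= N.
Proof.
move=> k0; elim: ps A => [|p ps IHps] A A0 AN /=; first by case=> <-.
case m: (mv k p A) => [C|]; last by rewrite run_None.
move=> /(IHps _ (mv0 k0 m A0) (mv_bound k0 m AN)) [psN BN]; split=> // q.
rewrite inE => /orP[/eqP ->|]; last exact: psN.
have [pA _ _] := mv_head k0 m; rewrite mem_iota add1n ltnS AN // andbT.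
by rewrite lt0n; apply: contraNneq A0 => <-.
Qed.

(** Two consecutive shapes determine the head between them, by [mv_inj]. The innermost shape does
    not occur in the chain, so it is compared separately. *)
Lemma chain_inj k ps ps' A B B' : 0 < k -> 0 \notin A ->
  run (mv k) ps (Some A) = Some B -> run (mv k) ps' (Some A) = Some B' ->
  chain k ps (Some A) = chain k ps' (Some A) -> sh B = sh B' -> ps = ps'.
Proof.
move=> k0; elim: ps ps' A => [|p ps IHps] [|p' ps'] A A0 //=.
- by move=> _ _ /(congr1 size); rewrite size_rcons.
- by move=> _ _ /(congr1 size); rewrite size_rcons.
case m: (mv k p A) => [C|]; last by rewrite run_None.
case m': (mv k p' A) => [C'|]; last by rewrite run_None.
move=> rB rB' /rcons_inj [cc] BB'.
have CC' : C = C'.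
  apply: sh_inj; [exact: mv0 m _ | exact: mv0 m' _ |].
  by rewrite -[sh C]/(osh (Some C)) -(last_chain rB) cc BB' (last_chain rB').
subst C'; rewrite (mv_inj k0 m m'); congr cons.
exact: IHps (mv0 k0 m A0) rB rB' cc BB'.
Qed.

Section Strips.
Variables (k : nat) (before : rel cell) (ord : rel nat).
Hypothesis k0 : 0 < k.
Hypothesis headsP : forall A B C p q, 0 \notin A ->
  mv k p A = Some B -> mv k q B = Some C ->
  before (cnt q B + q - 1, cnt q B) (cnt p A + p - 1, cnt p A) = ord p q.

Lemma ribbon_stripP D0 c A : 0 \notin A ->
  ribbon_strip before k D0 c (sh A) <->
  exists ps A0, [/\ sorted ord ps, run (mv k) ps (Some A) = Some A0,
                    D0 = sh A0 & c = chain k ps (Some A)].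
Proof.
elim/last_ind: c A => [|c D IHc] A nA0.
  rewrite ribbon_strip_nil; split=> [->|[[|p ps] [A0 [_ /= rA -> //]]]].
  - by exists [::], A.
  - by case: rA => ->.
  - by move=> /(congr1 size); rewrite size_rcons.
rewrite ribbon_strip_rcons; split.
  move=> [-> sc [sub rem [h kr]] hd].
  have [p [B [m EB _]]] := kribbon_mv k0 nA0 rem kr.
  have [BA _ _] := mv_kribbon k0 nA0 m; have nB0 := mv0 k0 m nA0.
  have EL : last D0 c = sh B by rewrite -(fsetDK sub) EB fsetDK.
  rewrite EL in sc; have [ps [A0 [sps rps D0E cE]]] := (IHc _ nB0).1 sc.
  exists (p :: ps), A0; split=> //=; rewrite ?m //=; last by rewrite -cE.
  case: ps sps rps cE => //= q ps sps rps cE; rewrite sps andbT.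
  (* A strip only provides some heads for each consecutive pair of ribbons. The moves found from
     them by [kribbon_mv] lead to the same shapes, so [mv_inj] identifies these heads with those of
     [q] and [p]. *)
  have [h1 [h2 [kr1 kr2 hb]]] := hd _ _ cE.
  case mB: (mv k q B) rps cE kr1 => [C|]; last by rewrite run_None.
  move=> rps cE kr1; rewrite D0E (last_chain rps) /= in kr1.
  have [CB remB _] := mv_kribbon k0 nB0 mB.
  have [q' [C' [mB' EC Eh]]] := kribbon_mv k0 nB0 remB kr1.
  have CE : C' = C.
    have [CB' _ _] := mv_kribbon k0 nB0 mB'.
    apply: sh_inj; [exact: mv0 mB' _ | exact: mv0 mB _ |].
    by rewrite -(fsetDK CB') -EC fsetDK.
  rewrite CE in mB'; rewrite (mv_inj k0 mB' mB) in Eh.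
  have [BA' remA _] := mv_kribbon k0 nA0 m.
  have [p' [B' [m' EB' Eh']]] := kribbon_mv k0 nA0 remA kr2.
  have BE : B' = B.
    have [BA'' _ _] := mv_kribbon k0 nA0 m'.
    apply: sh_inj; [exact: mv0 m' _ | exact: mv0 m _ |].
    by rewrite -(fsetDK BA'') -EB' fsetDK.
  rewrite BE in m'; rewrite (mv_inj k0 m' m) in Eh'.
  by rewrite -(headsP nA0 m mB) -Eh -Eh'.
move=> [[|p ps] [A0 [sps /=]]]; first by move=> _ _ /(congr1 size); rewrite size_rcons.
case m: (mv k p A) => [B|]; last by rewrite run_None.
move=> rps D0E /rcons_inj [cE ->]; have nB0 := mv0 k0 m nA0.
have [BA remA kA] := mv_kribbon k0 nA0 m.
have lE : last D0 c = sh B by rewrite D0E cE (last_chain rps).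
rewrite lE; split=> //; first by apply/IHc => //; exists ps, A0; rewrite (path_sorted sps).
  by split=> //; exists (cnt p A + p - 1, cnt p A).
move=> c' F cF; rewrite cF in cE; case: ps sps rps cE => [|q ps] /=.
  by move=> _ _ /(congr1 size); rewrite size_rcons.
move=> /andP[pq _]; case mB: (mv k q B) => [C|]; last by rewrite run_None.
move=> rps /rcons_inj [-> ->]; rewrite D0E (last_chain rps) /=.
have [_ _ kB] := mv_kribbon k0 nB0 mB.
by exists (cnt q B + q - 1, cnt q B), (cnt p A + p - 1, cnt p A); rewrite (headsP nA0 m mB).
Qed.

End Strips.

Lemma horizontal_stripP k D0 c A : 0 < k -> 0 \notin A ->
  horizontal_strip k D0 c (sh A) <->
  exists ps A0, [/\ sorted gtn ps, run (mv k) ps (Some A) = Some A0,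
                    D0 = sh A0 & c = chain k ps (Some A)].
Proof.
move=> k0; apply: ribbon_stripP => // {}A B C p q A0 mA mB.
exact: horizontal_heads mA mB.
Qed.

Lemma vertical_stripP k D0 c A : 0 < k -> 0 \notin A ->
  vertical_strip k D0 c (sh A) <->
  exists ps A0, [/\ sorted ltn ps, run (mv k) ps (Some A) = Some A0,
                    D0 = sh A0 & c = chain k ps (Some A)].
Proof.
move=> k0; apply: ribbon_stripP => // {}A B C p q A0 mA mB.
exact: vertical_heads mA mB.
Qed.

Definition coreb (k N : nat) (A : {fset nat}) : bool :=
  all (fun p => ~~ mv k p A) (iota 1 N).

Lemma kcoreP k N A : 0 < k -> 0 \notin A -> (forall q, q \in A -> q <= N) ->
  kcore k (sh A) <-> coreb k N A.
Proof.
move=> k0 A0 AN; split=> [[_ noU]|/allP noM].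
  apply/allP => p _; case m: (mv k p A) => [B|] //.
  have [_ rem kr] := mv_kribbon k0 A0 m.
  by case: (noU _ rem); exists (cnt p A + p - 1, cnt p A).
split=> [|U rem [h kr]]; first exact: sh_shifted.
have [p [B [m _ _]]] := kribbon_mv k0 A0 rem kr.
have [pA _ _] := mv_head k0 m.
have pN : p \in iota 1 N.
  rewrite mem_iota add1n ltnS AN // andbT lt0n.
  by apply: contraNneq A0 => <-.
by have := noM p pN; rewrite m.
Qed.

Lemma sorted_ltn_subseq_iota N ps : sorted ltn ps -> {subset ps <= iota 1 N} ->
  subseq ps (iota 1 N).
Proof.
move=> sps psN.
have -> : ps = filter (mem ps) (iota 1 N).
  apply: (irr_sorted_eq (leT := ltn)) => //; [exact: ltn_trans | exact: ltnn | |].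
    by apply: sorted_filter; [exact: ltn_trans | exact: iota_ltn_sorted].
  by move=> x; rewrite mem_filter /=; case: (boolP (x \in ps)) => // /psN.
exact: filter_subseq.
Qed.

Lemma sorted_gtn_subseq_iota N ps : sorted gtn ps -> {subset ps <= iota 1 N} ->
  subseq ps (rev (iota 1 N)).
Proof.
move=> sps psN; rewrite -[ps]revK subseq_rev; apply: sorted_ltn_subseq_iota.
  by rewrite rev_sorted.
by move=> x; rewrite mem_rev => /psN.
Qed.

(** * Ribbon tableaux *)

Section Tableaux.
Variables (k m N : nat) (A : {fset nat}).
Hypotheses (k0 : 0 < k) (nA0 : 0 \notin A) (AN : forall q, q \in A -> q <= N).

(** The beads of the shape [lambda^(i)]: the entries of [h] from index [i] on have been removed. *)
Let st (h : history nat) i := replay (mv k) (drop i h) (Some A).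
Let vh (h : history nat) i := nth ([::], [::]) h i.

Definition history_tableau (h : history nat) : tableau_data m :=
  ([ffun i : 'I_m.+1 => osh (st h i)],
   [ffun i : 'I_m => osh (run (mv k) (vh h i).2 (st h i.+1))],
   [ffun i : 'I_m => chain k (vh h i).1 (run (mv k) (vh h i).2 (st h i.+1))],
   [ffun i : 'I_m => chain k (vh h i).2 (st h i.+1)]).

Lemma st_step h i : i < size h ->
  st h i = run (mv k) (vh h i).1 (run (mv k) (vh h i).2 (st h i.+1)).
Proof. by move=> ih; rewrite /st (drop_nth ([::], [::])). Qed.

Lemma replay_mv0 h B : replay (mv k) h (Some A) = Some B ->
  0 \notin B /\ forall q, q \in B -> q <= N.
Proof.
elim: h B => [|[v u] h IHh] B /=; first by case=> <-.
case rh: (replay _ h _) => [C|]; last by rewrite !run_None.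
have [C0 CN] := IHh _ rh.
case ru: (run _ u _) => [E|]; last by rewrite run_None.
have E0 := run_mv0 k0 C0 ru; have [_ EN] := run_mv_bound k0 C0 CN ru.
by move=> rv; split; [exact: run_mv0 rv | have [] := run_mv_bound k0 E0 EN rv].
Qed.

Lemma replay_drop h i B : replay (mv k) h (Some A) = Some B ->
  exists C, st h i = Some C.
Proof.
rewrite -{1}(cat_take_drop i h) replay_cat -/(st h i).
by case: (st h i) => [C _|]; [exists C | rewrite replay_None].
Qed.

Definition valid_history (h : history nat) : bool :=
  (h \in histories (iota 1 N) m) && oapp (coreb k N) false (replay (mv k) h (Some A)).

Lemma valid_history_tableau h :
  valid_history h -> ribbon_tableau k (sh A) (history_tableau h).
Proof.
rewrite /valid_history mem_histories.
case rh: (replay _ h _) => [B|]; last by rewrite andbF.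
move=> /= /andP[/andP[/eqP sh_ sub]] coreB.
have vhs (i : 'I_m) : subseq (vh h i).1 (iota 1 N) /\ subseq (vh h i).2 (rev (iota 1 N)).
  have iN : vh h i \in h by apply: mem_nth; rewrite sh_ ltn_ord.
  by have /andP[] := allP sub _ iN.
have st1 i : exists C, [/\ st h i = Some C, 0 \notin C & forall q, q \in C -> q <= N].
  have [C stC] := replay_drop i rh; exists C.
  by have [C0 CN] := replay_mv0 stC.
split.
- rewrite ffunE /= /st drop0 rh /=; have [B0 BN] := replay_mv0 rh.
  by apply/(kcoreP k0 B0 BN).
- move=> i; rewrite !ffunE /= st_step ?sh_ //.
  have [C [stC C0 CN]] := st1 i.+1; have [v u] := vhs i.
  have [E [stE _ _]] := st1 i; rewrite st_step ?sh_ // stC in stE *.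
  case ru: (run _ _ (Some C)) stE => [F|]; last by rewrite run_None.
  have F0 := run_mv0 k0 C0 ru.
  move=> stE; rewrite stE; apply/vertical_stripP => //; exists (vh h i).1, E; split=> //.
  by apply: subseq_sorted v (iota_ltn_sorted _ _); exact: ltn_trans.
- move=> i; rewrite !ffunE lift0.
  have [C [stC C0 CN]] := st1 i.+1; have [v u] := vhs i.
  have [E [stE _ _]] := st1 i; rewrite st_step ?sh_ // stC in stE *.
  case ru: (run _ _ (Some C)) stE => [F|]; last by rewrite run_None.
  move=> stE; apply/horizontal_stripP => //; exists (vh h i).2, F; split=> //.
  apply: subseq_sorted u _; first by move=> a b c /= ba ac; exact: ltn_trans ac ba.
  by rewrite rev_sorted; exact: iota_ltn_sorted.
- by rewrite ffunE /st /= drop_oversize // sh_.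
Qed.

Lemma history_tableau_inj h1 h2 : valid_history h1 -> valid_history h2 ->
  history_tableau h1 = history_tableau h2 -> h1 = h2.
Proof.
rewrite /valid_history !mem_histories.
case r1: (replay _ h1 _) => [B1|]; last by rewrite andbF.
case r2: (replay _ h2 _) => [B2|]; last by rewrite andbF.
move=> /andP[/andP[/eqP s1 _] _] /andP[/andP[/eqP s2 _] _] [] E1 E2 E3 E4.
(* The comparison goes from the outer shape inward, since [st h i] depends only on the entries from
   index [i] on. *)
suff H j : j <= m -> drop (m - j) h1 = drop (m - j) h2.
  by have := H m (leqnn m); rewrite subnn !drop0.
elim: j => [|j IHj] jm; first by rewrite subn0 !drop_oversize ?s1 ?s2.
pose i := m - j.+1; have im : i < m by rewrite /i; lia.
have iS : m - j = i.+1 by rewrite /i; lia.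
have Ed : drop i.+1 h1 = drop i.+1 h2 by rewrite -iS IHj // ltnW.
rewrite -/i (drop_nth ([::], [::])) ?s1 // [RHS](drop_nth ([::], [::])) ?s2 // Ed.
congr cons; rewrite -/(vh h1 i) -/(vh h2 i).
have [C stC] := replay_drop i.+1 r1.
have stC2 : st h2 i.+1 = Some C by rewrite /st -Ed.
have [C0 CN] := replay_mv0 stC.
have [D1 stD1] := replay_drop i r1; have [D2 stD2] := replay_drop i r2.
rewrite st_step ?s1 // stC in stD1; rewrite st_step ?s2 // stC2 in stD2.
case ru1: (run _ (vh h1 i).2 _) stD1 => [F1|]; last by rewrite run_None.
case ru2: (run _ (vh h2 i).2 _) stD2 => [F2|]; last by rewrite run_None.
move=> stD2 stD1.
have F10 := run_mv0 k0 C0 ru1; have F20 := run_mv0 k0 C0 ru2.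
move/ffunP/(_ (Ordinal im)): E2; rewrite !ffunE /= stC stC2 ru1 ru2 /= => shF.
move/ffunP/(_ (Ordinal im)): E4; rewrite !ffunE /= stC stC2 => cu.
have Eu : (vh h1 i).2 = (vh h2 i).2 := chain_inj k0 C0 ru1 ru2 cu shF.
have EF := sh_inj F10 F20 shF; rewrite -{}EF in ru2 stD2 shF.
move/ffunP/(_ (Ordinal im)): E3; rewrite !ffunE /= stC stC2 ru1 ru2 => cv.
have im1 : i < m.+1 by rewrite ltnS ltnW.
move/ffunP/(_ (Ordinal im1)): E1; rewrite !ffunE /=.
rewrite (st_step (h := h1)) ?s1 // (st_step (h := h2)) ?s2 //.
rewrite stC stC2 ru1 ru2 stD1 stD2 => shD.
have Ev := chain_inj k0 F10 stD1 stD2 cv shD.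
by rewrite (surjective_pairing (vh h1 i)) (surjective_pairing (vh h2 i)) Eu Ev.
Qed.

Lemma tableau_history S : ribbon_tableau k (sh A) S ->
  exists2 h, valid_history h & S = history_tableau h.
Proof.
case: S => [[[lam lam'] vert] horiz] [core_lam vs hs lamA].
(* The history is built from its last entry: [h] holds the last [j] entries, so its index [t] is the
   index [m - j + t] of the tableau. *)
suff H j : j <= m -> exists h B, [/\ size h = j,
    all (fun vu => subseq vu.1 (iota 1 N) && subseq vu.2 (rev (iota 1 N))) h,
    replay (mv k) h (Some A) = Some B, 
    forall (i : 'I_m.+1) t, t <= j -> i = m - j + t :> nat -> lam i = osh (st h t) &
    forall (i : 'I_m) t, t < j -> i = m - j + t :> nat ->
      [/\ lam' i = osh (run (mv k) (vh h t).2 (st h t.+1)),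
          vert i = chain k (vh h t).1 (run (mv k) (vh h t).2 (st h t.+1)) &
          horiz i = chain k (vh h t).2 (st h t.+1)]].
  have [h [B [hm hsub hB lamE E]]] := H m (leqnn m); rewrite subnn in lamE E.
  exists h.
    rewrite /valid_history mem_histories hm eqxx hsub hB /=.
    have [B0 BN] := replay_mv0 hB; apply/(kcoreP k0 B0 BN).
    by rewrite (lamE ord0 0) // /st drop0 hB in core_lam.
  congr (_, _, _, _); apply/ffunP => i; rewrite ffunE.
  - by apply: lamE; rewrite // -ltnS.
  - by have [] := E i i (ltn_ord i) (erefl _).
  - by have [] := E i i (ltn_ord i) (erefl _).
  - by have [] := E i i (ltn_ord i) (erefl _).
elim: j => [|j IHj] jm.
  exists [::], A; split=> // i t; rewrite leqn0 => /eqP -> im.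
  by rewrite /st /= -lamA; congr (lam _); apply: val_inj; rewrite /= im; lia.
have [h [B [hm hsub hB lamE E]]] := IHj (ltnW jm).
have im : m - j.+1 < m by lia.
pose i0 := Ordinal im; have [B0 BN] := replay_mv0 hB.
have lamB : lam (lift ord0 i0) = sh B.
  by rewrite (lamE _ 0) ?lift0 /st ?drop0 ?hB //=; lia.
have := hs i0; rewrite lamB => /(horizontal_stripP _ _ k0 B0) [u [A1 [su ru lam'E uE]]].
have A10 := run_mv0 k0 B0 ru; have [uN A1N] := run_mv_bound k0 B0 BN ru.
have := vs i0; rewrite lam'E => /(vertical_stripP _ _ k0 A10) [v [A2 [sv rv lam2E vE]]].
have A20 := run_mv0 k0 A10 rv; have [vN A2N] := run_mv_bound k0 A10 A1N rv.
exists ((v, u) :: h), A2; split=> /=.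
- by rewrite hm.
- by rewrite hsub sorted_ltn_subseq_iota // sorted_gtn_subseq_iota.
- by rewrite hB ru.
- move=> i [|t] tj it; last by rewrite (lamE i t) //; lia.
  rewrite /st /= hB ru rv /= -lam2E; congr (lam _); apply: val_inj.
  by rewrite /= it; lia.
- move=> i [|t] tj it; last by apply: (E i t) => //; lia.
  have -> : i = i0 by apply: val_inj; rewrite /= it; lia.
  by rewrite /st /= drop0 hB ru /=.
Qed.

End Tableaux.

Local Open Scope ring_scope.

Definition var_of_nat (m i : nat) : {mpoly int[m]} :=
  oapp (fun i : 'I_m => 'X_i) 0 (insub i).

Lemma var_of_natE m (i : 'I_m) : var_of_nat m i = 'X_i.
Proof. by rewrite /var_of_nat valK. Qed.

Definition vars (m : nat) : seq {mpoly int[m]} :=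
  [seq var_of_nat m i | i <- rev (iota 0 m)].

(** A tableau is determined by the heads of its ribbons, so the tableaux are the images of the valid
    histories, without repetition. The finitely supported sum becomes a sum over that finite
    list. *)
Lemma RQ_opw k m N la : (0 < k)%N -> strict_partition la ->
    (forall q, q \in la -> (q <= N)%N) ->
  RQ k m la = opw (mv k) (wordw (vars m) (rev (iota 1 N) ++ iota 1 N))
                (fun A => (coreb k N A)%:R) (seq_fsetn la).
Proof.
move=> k0 /andP[sla la0] laN; set A := seq_fsetn la.
have A0 : 0%N \notin A by rewrite seq_fsetnE.
have AN q : q \in A -> (q <= N)%N by rewrite seq_fsetnE; exact: laN.
have := opw_histories (mv k) (iota 1 N) (var_of_nat m) m
  (fun A => (coreb k N A)%:R) (Some A).
rewrite /= => ->; rewrite /RQ shdiag_sh // -/A.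
rewrite (eq_big_seq (fun h => if oapp (coreb k N) false (replay (mv k) h (Some A))
    then tableau_weight (history_tableau k m A h) else 0)); last first.
  move=> h; rewrite mem_histories => /andP[/eqP hm _].
  case: (replay _ h _) => [B|] /=; last by rewrite mulr0.
  case: ifP => _; rewrite ?mulr0 // mulr1; apply: eq_bigr => i _.
  by rewrite var_of_natE !ffunE !size_chain.
rewrite -big_mkcond -big_filter -(big_map (history_tableau k m A) xpredT
  (@tableau_weight m)).
set hs := [seq h <- _ | _].
have -> : [set S : tableau_data m | ribbon_tableau k (sh A) S]%classic =
    [set` map (history_tableau k m A) hs]%classic.
  apply/seteqP; split=> S /=.
    move=> /(tableau_history k0 A0 AN) [h vh ->]; apply: map_f.
    by rewrite mem_filter andbC.
  case/mapP => h; rewrite mem_filter andbC => vh ->.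
  exact: (valid_history_tableau k0 A0 AN).
rewrite -fsbig_seq // map_inj_in_uniq ?filter_uniq ?histories_uniq ?iota_uniq //.
move=> h1 h2; rewrite !mem_filter ![_ && (_ \in _)]andbC.
exact: (history_tableau_inj k0 A0 AN).
Qed.

Local Close Scope ring_scope.

(** * Shifted tableaux *)

Lemma mv1_cnt d A B : mv 1 d A = Some B ->
  0 < d /\ forall e, 0 < e -> cnt e A = cnt e B + (e == d).
Proof.
move=> m1; have [d1 AB] := mv_cnt (ltn0Sn 0) m1; split; first lia.
by move=> e e0; rewrite AB // /ribbon_cells; lia.
Qed.

Lemma mv1_some d A : 0 < d -> d \in A -> (1 < d -> d - 1 \notin A) ->
  exists B, mv 1 d A = Some B.
Proof.
move=> d0 dA dA'; rewrite /mv dA /=; have -> : (d < 1) = false by lia.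
case: eqP => [_|d1]; first by eexists.
by rewrite (negPf (dA' _)); [eexists | lia].
Qed.

Lemma sh_closed_row A c c' r : (c', r) \in sh A -> r <= c <= c' -> (c, r) \in sh A.
Proof.
rewrite !mem_sh => /and3P[-> rc' rA] /andP[-> cc'] /=; apply: leq_trans rA _.
by apply: cnt_le; lia.
Qed.

Lemma sh_closed_col A c r r' : (c, r') \in sh A -> 0 < r <= r' -> (c, r) \in sh A.
Proof.
rewrite !mem_sh => /and3P[r'0 r'c rA] /andP[-> rr'] /=.
have -> : r <= c by lia.
have := @cnt_sub (c - r' + 1) (r' - r) A.
have -> : c - r' + 1 + (r' - r) = c - r + 1 by lia.
by lia.
Qed.

Lemma sh_mv1 d A B : mv 1 d A = Some B ->
  sh A = (cnt d A + d - 1, cnt d A) |` sh B /\ (cnt d A + d - 1, cnt d A) \notin sh B.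
Proof.
move=> m1; have [d0 AB] := mv1_cnt m1; have ABd := AB d d0; rewrite eqxx in ABd.
split; last by rewrite mem_sh_diag //; lia.
apply/fsetP => -[c r]; rewrite !inE !mem_sh xpair_eqE.
case: (posnP r) => [->|r0] /=.
  have -> : (0 == cnt d A) = false by lia.
  by rewrite andbF.
case: (leqP r c) => rc /=; last by lia.
rewrite AB ?addn1 //; case: eqP => [E|E]; last by lia.
by rewrite E; lia.
Qed.

Section Fillings.
Variables (m : nat) (LA MU : {fset nat}).
Hypotheses (LA0 : 0 \notin LA) (MU0 : 0 \notin MU).

Let U : diagram := sh LA `\` sh MU.
(** [None] marks the cells outside the current shape, so that all intermediate shapes share the
    domain [U]. *)
Let filling := {ffun U -> option (letter m)}.

Definition ok_pair (x y : cell) (a b : letter m) : bool :=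
  ((x.2 == y.2) && (x.1 < y.1) ==> letter_le a b && ~~ ((a == b) && marked a)) &&
  ((x.1 == y.1) && (x.2 < y.2) ==> letter_le a b && ~~ ((a == b) && ~~ marked a)).

(** [w] is what remains of the reading word: an entry [a] on the diagonal [d] is allowed only if
    [(a, d)] is still in [w]. *)
Definition filling_of (w : seq (letter m * nat)) B (T : filling) : bool :=
  [&& sh MU `<=` sh B,
      [forall x : U, (val x \in sh B) == isSome (T x)],
      [forall x : U, oapp (fun a => (a, diag (val x)) \in w) true (T x)] &
      [forall x : U, forall y : U,
         oapp (fun a => oapp (ok_pair (val x) (val y) a) true (T y)) true (T x)]].

Lemma filling_ofP w B (T : filling) : reflect
  [/\ sh MU `<=` sh B,
      forall x : U, (val x \in sh B) = isSome (T x),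
      forall x a, T x = Some a -> (a, diag (val x)) \in w &
      forall x y a b, T x = Some a -> T y = Some b -> ok_pair (val x) (val y) a b]
  (filling_of w B T).
Proof.
apply: (iffP and4P) => -[muB TB Tw Tok]; split=> //.
- by move=> x; apply/eqP; apply: (forallP TB).
- by move=> x a Tx; have := forallP Tw x; rewrite Tx.
- by move=> x y a b Tx Ty; have := forallP (forallP Tok x) y; rewrite Tx /= Ty.
- by apply/forallP => x; rewrite TB.
- by apply/forallP => x; case Tx: (T x) => [a|] //=; apply: Tw.
apply/forallP => x; apply/forallP => y.
by case Tx: (T x) => [a|] //=; case Ty: (T y) => [b|] //=; apply: Tok.
Qed.

(* v is read before v' when cells are removed from the largest entry on: the
   unmarked entries from right to left, the marked ones from top to bottom. *)
Definition read_before (v v' : letter m * nat) : bool :=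
  (letter_rank v'.1 < letter_rank v.1) ||
  ((v.1 == v'.1) && (if marked v.1 then v.2 < v'.2 else v'.2 < v.2)).

(** The pair at the front of the reading word can only sit at an outer corner: a filled cell to the
    right of it or above it would have to be read earlier. *)
Lemma max_cell a d w B T x :
    all (read_before (a, d)) w -> sh B `<=` sh LA ->
    filling_of ((a, d) :: w) B T -> T x = Some a -> diag (val x) = d ->
  (exists B', mv 1 d B = Some B') /\ val x = (cnt d B + d - 1, cnt d B).
Proof.
move=> /allP bef BLA /filling_ofP [muB TB Tw Tok] Tx xd.
have xB : val x \in sh B by rewrite TB Tx.
have := valP x; rewrite inE => /andP[xmu _].
have [r0 d0 xE] := cellE BLA xB; rewrite xd in d0 xE.
move: (val x).2 r0 xE => r r0 xE.
have nbr y : y \in sh B -> y \notin sh MU -> diag y != d -> exists b,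
    [/\ ok_pair (val x) y a b, ok_pair y (val x) b a & read_before (a, d) (b, diag y)].
  move=> yB ymu yd; have yU : y \in U by rewrite inE ymu (fsubsetP BLA).
  have := TB [` yU]; rewrite /= yB; case Ty: (T _) => [b|] // _; exists b.
  split; [exact: Tok Tx Ty | exact: Tok Ty Tx |].
  by have := Tw _ _ Ty; rewrite inE => /orP[/eqP[_ /eqP]|/bef //]; rewrite /= (negPf yd).
have rB : r <= cnt d B by rewrite xE mem_sh_diag in xB.
have rmu : cnt d MU < r by rewrite xE mem_sh_diag // -ltnNge in xmu.
(* Otherwise the cell to the right is filled with an entry at least [a] but read after [(a, d)]. It
   equals [a], which is then unmarked, and unmarked entries are read from right to left. *)
have right : cnt d.+1 B < r.
  rewrite ltnNge; apply/negP => rB'.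
  have yd : diag (r + d, r) = d.+1 by rewrite /diag /=; lia.
  have [||| b] := nbr (r + d, r).
  - by have := mem_sh_diag B (ltn0Sn d) r0; rewrite rB' addnS subn1.
  - have := mem_sh_diag MU (ltn0Sn d) r0; rewrite addnS subn1 /= => ->.
    by rewrite -ltnNge; apply: leq_ltn_trans rmu; apply: cnt_le.
  - by rewrite yd; lia.
  have lt : r + d - 1 < r + d by lia.
  rewrite /ok_pair /read_before xE yd /letter_le /= eqxx lt /=.
  move=> [/andP[/andP[ab nm] _] _]; rewrite ltnNge ab /= => /andP[/eqP E].
  by move: nm; rewrite E eqxx /=; case: (marked b) => // _; lia.
have rE : r = cnt d B by have := cntS d B; case: (d \in B) => /=; lia.
have dB : d \in B by have := cntS d B; case: (d \in B) => //=; lia.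
split; last by rewrite xE -rE.
(* The cell above lies on the diagonal [d - 1]; for [d = 1] it would be outside every shifted
   diagram. An equal entry there is marked, and marked entries are read from top to bottom. *)
apply: mv1_some => // d1; apply/negP => d1B.
have rB' : r < cnt (d - 1) B.
  by have := cntS (d - 1) B; rewrite d1B subn1 prednK //; lia.
have yd : diag (r + d - 1, r.+1) = d - 1 by rewrite /diag /=; lia.
have d10 : 0 < d - 1 by lia.
have yE : (r + d - 1, r.+1) = (r.+1 + (d - 1) - 1, r.+1) :> cell by congr pair; lia.
have [||| b] := nbr (r + d - 1, r.+1).
- by rewrite yE mem_sh_diag.
- rewrite yE mem_sh_diag // -ltnNge; apply: leq_ltn_trans (cnt_sub (d - 1) 1 MU) _.
  by rewrite subnK; lia.
- by rewrite yd; lia.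
rewrite /ok_pair /read_before xE yd /letter_le /= eqxx ltnSn /=.
move=> [/andP[_ /andP[ab nm]] _]; rewrite ltnNge ab /= => /andP[/eqP E].
by move: nm; rewrite E eqxx /=; case: (marked b) => // _; lia.
Qed.

Section OneCell.
Variables (a : letter m) (d : nat) (w : seq (letter m * nat)) (B B' : {fset nat}) (x0 : U).
Hypotheses (bef : all (read_before (a, d)) w) (BLA : sh B `<=` sh LA).
Hypotheses (mB : mv 1 d B = Some B') (x0E : val x0 = (cnt d B + d - 1, cnt d B)).

Definition add_cell (T : filling) : filling := [ffun x => if x == x0 then Some a else T x].
Definition del_cell (T : filling) : filling := [ffun x => if x == x0 then None else T x].

Let memB x : (x \in sh B) = (x == val x0) || (x \in sh B').
Proof. by have [-> _] := sh_mv1 mB; rewrite x0E !inE. Qed.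

Let x0B' : val x0 \notin sh B'.
Proof. by have [_] := sh_mv1 mB; rewrite x0E. Qed.

Lemma filling_del T : filling_of ((a, d) :: w) B T -> T x0 = Some a ->
  filling_of w B' (del_cell T).
Proof.
move=> FT Tx0; have [muB TB Tw Tok] := filling_ofP _ _ _ FT; apply/filling_ofP; split.
- apply/fsubsetP => y ymu; have := fsubsetP muB _ ymu; rewrite memB.
  case/orP => // /eqP yx0; have := valP x0.
  by rewrite inE -yx0 ymu.
- move=> x; rewrite ffunE; case: eqP => [->|/eqP xx0]; first exact/negbTE/x0B'.
  by rewrite -TB memB val_eqE (negPf xx0).
- move=> x b; rewrite ffunE; case: eqP => // xx0 Tx.
  have := Tw _ _ Tx; rewrite inE => /orP[/eqP [ba xd]|//]; rewrite ba in Tx.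
  have [_ xE] := max_cell bef BLA FT Tx xd.
  by case: xx0; apply: val_inj; rewrite x0E.
- move=> x y b c; rewrite !ffunE; case: eqP => // _ Tx; case: eqP => // _ Ty.
  exact: Tok.
Qed.

Lemma filling_add T : filling_of w B' T -> filling_of ((a, d) :: w) B (add_cell T).
Proof.
move=> /filling_ofP [muB TB Tw Tok]; have [d0 _] := mv1_cnt mB.
have x0r : 0 < (val x0).2.
  by have := mv_head (ltn0Sn 0) mB; rewrite x0E => -[_ _ /= ->].
have x0d : diag (val x0) = d by rewrite x0E /diag /=; lia.
have x0c : (val x0).2 <= (val x0).1 by rewrite x0E /=; lia.
apply/filling_ofP; split.
- by apply/fsubsetP => y /(fsubsetP muB); rewrite memB orbC => ->.
- by move=> x; rewrite ffunE memB val_eqE TB; case: eqP.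
- move=> x b; rewrite ffunE; case: eqP => [-> [<-]|_ Tx]; first by rewrite x0d mem_head.
  by rewrite inE (Tw _ _ Tx) orbT.
move=> x y b c; rewrite !ffunE.
case: eqP => [-> [<-]|/eqP xx0 Tx].
  case: eqP => [-> _|/eqP yx0 Ty]; first by rewrite /ok_pair !ltnn !andbF.
  have yB : val y \in sh B' by rewrite TB Ty.
  move: (val x0) (val y) yB x0B' x0r x0c => [c0 r0] [c1 r1] /= yB nB r00 rc0.
  rewrite /ok_pair /=; apply/andP; split; apply/implyP => /andP[/eqP E lt]; case/negP: nB.
    by rewrite -E in yB; apply: sh_closed_row yB _; rewrite rc0 ltnW.
  by rewrite -E in yB; apply: sh_closed_col yB _; rewrite r00 ltnW.
case: eqP => [-> [<-]|/eqP yx0 Ty]; last exact: Tok.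
have xd := allP bef _ (Tw _ _ Tx).
have [x1 _] : (val x).2 <= (val x).1 /\ true.
  split=> //; have : val x \in sh B' by rewrite TB Tx.
  by case: (val x) => c0 r0; rewrite mem_sh => /and3P[].
move: xd; rewrite -x0d /read_before /ok_pair /letter_le [_.1 == _]eq_sym /diag.
move: (val x0) (val x) x0c x1 => [c0 r0] [c1 r1] /= rc0 rc1.
case: eqP => [->|_]; last first.
  rewrite /= orbF => ba; rewrite (ltnW ba) /=.
  by apply/andP; split; apply/implyP.
rewrite ltnn leqnn /=; case: (marked a) => /= h.
  by apply/andP; split; apply/implyP => /andP[/eqP E lt] //; exfalso; lia.
by apply/andP; split; apply/implyP => /andP[/eqP E lt] //; exfalso; lia.
Qed.

End OneCell.

Local Open Scope ring_scope.

Definition filling_weight (T : filling) : {mpoly int[m]} :=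
  \prod_x oapp (fun a : letter m => 'X_(a.1)) 1 (T x).

Definition weigh (w : seq (letter m * nat)) : seq ({mpoly int[m]} * nat) :=
  [seq ('X_(v.1.1), v.2) | v <- w].

(** Split by whether the first pair of the word occurs. If it does not, it can be struck from the
    word; if it does, it fills the corner of [sh B] on its diagonal, and erasing that cell leaves a
    filling of the smaller shape. This is the recursion of [opw]. *)
Lemma sum_fillings w B : pairwise read_before w -> sh B `<=` sh LA -> 0%N \notin B ->
  \sum_(T | filling_of w B T) filling_weight T =
  opw (mv 1) (weigh w) (fun B => (B == MU)%:R) B.
Proof.
elim: w B => [|[a d] w IHw] B /=.
  move=> _ BLA B0; case: eqP => [->|BMU].
    rewrite (big_pred1 [ffun=> None]).
      by rewrite /filling_weight big1 // => x _; rewrite ffunE.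
    move=> T; apply/filling_ofP/eqP => [[_ _ Tw _]|->].
      by apply/ffunP => x; rewrite ffunE; case Tx: (T x) => [b|] //; have := Tw _ _ Tx.
    split=> //; try by move=> x *; rewrite ffunE.
    - by move=> x; rewrite ffunE /=; have := valP x; rewrite inE => /andP[/negPf ->].
    - by move=> x b; rewrite ffunE.
    - by move=> x y b c; rewrite ffunE.
  rewrite big_pred0 // => T; apply/negP => /filling_ofP [muB TB Tw _]; apply: BMU.
  apply: sh_inj => //; apply/eqP; rewrite eqEfsubset muB andbT.
  apply/fsubsetP => y yB; apply: contrapT => /negP ymu.
  have yU : y \in U by rewrite inE ymu (fsubsetP BLA).
  have := TB [` yU]; rewrite /= yB; case Ty: (T _) => [b|] // _.
  by have := Tw _ _ Ty.
move=> /andP[bef pw] BLA B0.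
pose used (T : filling) := [exists x : U, (T x == Some a) && (diag (val x) == d)].
rewrite (bigID used) /= addrC; congr +%R.
  rewrite -IHw //; apply: eq_bigl => T; apply/andP/idP.
    move=> [/filling_ofP [muB TB Tw Tok] /existsPn nu]; apply/filling_ofP; split=> //.
    move=> x b Tx; have := Tw _ _ Tx; rewrite inE => /orP[/eqP [ba xd]|//].
    by have := nu x; rewrite Tx ba xd !eqxx.
  move=> /filling_ofP [muB TB Tw Tok]; split.
    by apply/filling_ofP; split=> // x b /Tw; rewrite inE orbC => ->.
  apply/existsPn => x; apply/negP => /andP[/eqP Tx /eqP xd].
  have := allP bef _ (Tw _ _ Tx); rewrite /read_before xd ltnn eqxx /=.
  by rewrite ltnn if_same.
case mB: (mv 1 d B) => [B'|] /=; last first.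
  rewrite mulr0 big_pred0 // => T; apply/negP => /andP[FT /existsP [x /andP[/eqP Tx /eqP xd]]].
  by have [[B']] := max_cell bef BLA FT Tx xd; rewrite mB.
have [BE c0B'] := sh_mv1 mB; have B'0 := mv0 (ltn0Sn 0) mB B0.
have B'LA : sh B' `<=` sh LA by apply: fsubset_trans BLA; rewrite BE fsubsetUr.
(* The corner may belong to the inner shape; then both sums are empty. *)
have [c0U|c0U] := boolP ((cnt d B + d - 1, cnt d B)%N \in U); last first.
  rewrite -IHw // !big_pred0 ?mulr0 // => T.
    apply/negP => /filling_ofP [muB' _ _ _]; case/negP: c0U; rewrite inE.
    rewrite (fsubsetP BLA) ?BE ?inE ?eqxx // andbT.
    by apply: contra c0B' => /(fsubsetP muB').
  apply/negP => /andP[FT /existsP [x /andP[/eqP Tx /eqP xd]]].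
  by have [_ xE] := max_cell bef BLA FT Tx xd; case/negP: c0U; rewrite -xE; apply: valP.
pose x0 : U := [` c0U]; have d0 : (0 < d)%N by have [] := mv1_cnt mB.
have x0d : diag (val x0) = d by rewrite /diag /=; lia.
have usedE T : filling_of ((a, d) :: w) B T -> used T -> T x0 = Some a.
  move=> FT /existsP [x /andP[/eqP Tx /eqP xd]].
  have [_ xE] := max_cell bef BLA FT Tx xd.
  by have -> : x0 = x by apply: val_inj.
rewrite (reindex_onto (add_cell a x0) (del_cell x0)) /=; last first.
  move=> T /andP[FT uT]; apply/ffunP => x; rewrite !ffunE; case: eqP => // ->.
  by rewrite (usedE _ FT uT).
rewrite -IHw // mulr_sumr; apply: eq_big => T; last first.
  move=> /andP[/andP[FT _] /eqP Tx0].
  rewrite /filling_weight (bigD1 x0) //= [in RHS](bigD1 x0) //=.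
  rewrite -[in RHS]Tx0 !ffunE eqxx /= mul1r; congr *%R.
  by apply: eq_bigr => x xx0; rewrite !ffunE (negPf xx0).
apply/andP/idP.
  move=> [/andP[FT uT] /eqP Tx0].
  have Fx0 : add_cell a x0 T x0 = Some a by rewrite ffunE eqxx.
  by have := filling_del bef BLA mB (erefl _ : val x0 = _) FT Fx0; rewrite Tx0.
move=> FT; split.
  rewrite (filling_add bef BLA mB (erefl _ : val x0 = _) FT) /=.
  by apply/existsP; exists x0; rewrite ffunE eqxx x0d !eqxx.
apply/eqP/ffunP => x; rewrite !ffunE; case: eqP => // ->.
have [_ TB _ _] := filling_ofP _ _ _ FT; have := TB x0; rewrite (negPf c0B').
by case: (T x0).
Qed.

Local Close Scope ring_scope.
End Fillings.

Section ReadingWord.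
Variables (m : nat) (ds : seq nat).
Hypothesis ds_sorted : sorted ltn ds.

Definition letter_reading (i : 'I_m) : seq (letter m * nat) :=
  [seq ((i, false), d) | d <- rev ds] ++ [seq ((i, true), d) | d <- ds].

Definition reading_word : seq (letter m * nat) :=
  flatten [seq letter_reading i | i <- rev (enum 'I_m)].

Lemma mem_letter_reading i v :
  (v \in letter_reading i) = (v.1.1 == i) && (v.2 \in ds).
Proof.
case: v => [[j b] d]; rewrite mem_cat /=; apply/orP/andP.
  by case=> /mapP [e]; rewrite ?mem_rev => eds [-> _ ->].
by case=> /eqP -> dds; case: b; [right | left]; apply: map_f; rewrite ?mem_rev.
Qed.

Lemma mem_reading_word v : (v \in reading_word) = (v.2 \in ds).
Proof.
apply/flatten_mapP/idP => [[i _]|vds]; first by rewrite mem_letter_reading => /andP[].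
by exists v.1.1; rewrite ?mem_rev ?mem_enum // mem_letter_reading eqxx.
Qed.

Lemma pairwise_reading_word : pairwise (@read_before m) reading_word.
Proof.
have pds : pairwise ltn ds by rewrite -sorted_pairwise //; exact: ltn_trans.
have prds : pairwise gtn (rev ds).
  rewrite -sorted_pairwise ?rev_sorted //.
  by move=> a b c /= ba ac; exact: ltn_trans ac ba.
rewrite /reading_word; have: sorted (relpre val gtn) (rev (enum 'I_m)).
  by rewrite -sorted_map map_rev rev_sorted val_enum_ord; exact: iota_ltn_sorted.
rewrite sorted_pairwise; last by move=> a b c /= ba ac; exact: ltn_trans ac ba.
elim: (rev _) => //= i is_ IHis /andP[/allP iis pis].
rewrite pairwise_cat IHis // andbT; apply/andP; split.
  apply/allrelP => u v; rewrite mem_letter_reading => /andP[/eqP ui _].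
  case/flatten_mapP => j /iis /= ji; rewrite mem_letter_reading => /andP[/eqP vj _].
  rewrite /read_before /letter_rank ui vj.
  by case: (marked u.1); case: (marked v.1); lia.
rewrite /letter_reading pairwise_cat !pairwise_map; apply/and3P; split.
- apply/allrelP => _ _ /mapP [d _ ->] /mapP [e _ ->].
  by rewrite /read_before /letter_rank /= addn0 addn1 ltnSn.
- by apply: sub_pairwise prds => d e /= ed; rewrite /read_before /= eqxx ed orbT.
- by apply: sub_pairwise pds => d e /= ed; rewrite /read_before /= eqxx ed orbT.
Qed.

Lemma weigh_reading_word :
  weigh reading_word = wordw (vars m) (rev ds ++ ds).
Proof.
rewrite /vars -val_enum_ord -map_rev /reading_word.
elim: (rev _) => //= i is_ IHis; rewrite wordw_cons -IHis /weigh map_cat.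
congr cat; rewrite /letter_reading /letterw !map_cat -!map_comp.
by congr cat; apply: eq_map => d /=; rewrite var_of_natE.
Qed.

End ReadingWord.

(** Tableaux are the fillings of the full outer shape. The list [ds] may contain more than the
    diagonals of the skew shape, which lets one list serve all intermediate states. *)
Lemma Qskew_opw m la mu ds : strict_partition la -> strict_partition mu ->
    shdiag mu `<=` shdiag la -> sorted ltn ds ->
    (forall x, x \in shdiag la `\` shdiag mu -> diag x \in ds) ->
  Qskew m la mu = opw (mv 1) (wordw (vars m) (rev ds ++ ds))
    (fun B => (B == seq_fsetn mu)%:R%R) (seq_fsetn la).
Proof.
move=> /andP[sla la0] /andP[smu mu0]; rewrite /Qskew !shdiag_sh //.
set LA := seq_fsetn la; set MU := seq_fsetn mu => MULA sds Uds.
have LA0 : 0 \notin LA by rewrite seq_fsetnE.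
have MU0 : 0 \notin MU by rewrite seq_fsetnE.
rewrite -(weigh_reading_word m ds) -(sum_fillings LA0 MU0) ?fsubset_refl //; last first.
  exact: pairwise_reading_word.
pose h (T : {ffun sh LA `\` sh MU -> letter m}) : {ffun sh LA `\` sh MU -> option (letter m)} :=
  [ffun x => Some (T x)].
have h_inj : injective h.
  by move=> T T' /ffunP E; apply/ffunP => x; have := E x; rewrite !ffunE => -[].
rewrite (reindex_omap h (fun T' => [pick T | h T == T'])) /=; last first.
  move=> T' /filling_ofP [_ TB _ _].
  have some_T x : exists a, T' x = Some a.
    by have := TB x; rewrite (fsubsetP (fsubsetDl _ _) _ (valP x)); case: (T' x) => // a _; exists a.
  have [f fE] := fin_all_exists some_T.
  case: pickP => [T /eqP <- //|/(_ [ffun x => f x])].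
  by move/eqP; case; apply/ffunP => x; rewrite !ffunE fE.
apply: eq_big => T; last first.
  by move=> _; apply: eq_bigr => x _; rewrite ffunE.
have -> : [pick T0 | h T0 == h T] == Some T.
  by case: pickP => [T0 /eqP/h_inj ->//|/(_ T)]; rewrite eqxx.
rewrite andbT; apply/idP/filling_ofP => [sT|[_ _ _ Tok]].
  split=> //.
  - by move=> x; rewrite ffunE (fsubsetP (fsubsetDl _ _) _ (valP x)).
  - by move=> x a _; rewrite mem_reading_word; apply: Uds; exact: valP.
  - by move=> x y a b; rewrite !ffunE => -[<-] [<-]; apply: (forallP (forallP sT x) y).
apply/forallP => x; apply/forallP => y.
by apply: (Tok x y (T x) (T y)); rewrite ffunE.
Qed.

(** * Runners *)

Section Classes.
Variables (k n : nat).
Hypothesis k0 : 0 < k.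

(** The residues [c] and [k - c] form one class because a double ribbon deletes a bead of each.
    Class 0 consists of the multiples of [k], which the abacus lists as runner [k]. *)
Definition cls (p : nat) : nat := minn (p %% k) (k - p %% k).

Definition agree (c : nat) (A B : {fset nat}) : Prop :=
  forall p, cls p = c -> (p \in A) = (p \in B).

Lemma cls_sub p : k <= p -> cls (p - k) = cls p.
Proof. by move=> kp; rewrite /cls -[in RHS](subnK kp) modnDr. Qed.

Lemma cls_compl p : 0 < p < k -> cls (k - p) = cls p.
Proof.
move=> /andP[p0 pk]; rewrite /cls !modn_small //; last by lia.
by rewrite subKn 1?minnC // ltnW.
Qed.

Lemma cls_half p : cls p <= k %/ 2.
Proof. by rewrite /cls; have := ltn_pmod p k0; rewrite leq_divRL //; lia. Qed.

Lemma mv_agree_other p A B c : mv k p A = Some B -> c != cls p -> agree c A B.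
Proof.
rewrite /mv; case: ifPn => // /negPn pA.
have neq q r : cls q = c -> cls r = cls p -> c != cls p -> q != r.
  by move=> qc rp cp; apply: contraNneq cp => qr; rewrite -qc qr rp.
case: ltnP => pk.
  case: ifP => // /andP[kp _] [<-] cp q qc; rewrite !inE.
  have p0 : 0 < p by lia.
  by rewrite (neq q p qc _ cp) // (neq q (k - p) qc _ cp) // cls_compl ?p0.
case: eqP => [pk'|npk].
  by case=> <- cp q qc; rewrite !inE -pk' (neq q p qc _ cp).
case: ifP => // _ [<-] cp q qc; rewrite !inE.
by rewrite (neq q p qc _ cp) // (negPf (neq q (p - k) qc _ cp)) // cls_sub.
Qed.

Lemma mv_agree p A B : agree (cls p) A B ->
  match mv k p A, mv k p B with
  | Some A', Some B' => agree (cls p) A' B'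
  | None, None => True
  | _, _ => False
  end.
Proof.
move=> AB; rewrite /mv -AB //; case: ifP => // pA; case: ltnP => pk.
  case: (ltnP k p.*2) => //= kp; rewrite -AB; last by rewrite cls_compl //; lia.
  by case: ifP => // _ q qp; rewrite !inE AB.
case: eqP => [_ q qp|_]; first by rewrite !inE AB.
rewrite -AB ?cls_sub //; case: ifP => // _ q qp; by rewrite !inE AB.
Qed.

Definition core_of (c : nat) (A : {fset nat}) : bool :=
  all (fun p => ~~ mv k p A) [seq p <- iota 1 (k * n) | cls p == c].

Lemma core_of_agree c A B : agree c A B -> core_of c A = core_of c B.
Proof.
move=> AB; apply: eq_in_all => p; rewrite mem_filter => /andP[/eqP pc _].
rewrite -pc in AB; have := mv_agree AB.
by case: (mv k p A) => [?|]; case: (mv k p B) => [?|].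
Qed.

(** Being a core is tested head by head, hence class by class, so the final indicator factors as
    [opw_factor] requires. *)
Lemma prod_core_of (R : comNzRingType) A :
  ((coreb k (k * n) A)%:R = \prod_(c <- iota 0 (k %/ 2).+1) (core_of c A)%:R :> R)%R.
Proof.
have prodb (s : seq nat) (b : nat -> bool) :
    (\prod_(c <- s) (b c)%:R = (all b s)%:R :> R)%R.
  elim: s => [|c s IHs]; first by rewrite big_nil.
  by rewrite big_cons IHs /=; case: (b c); rewrite ?mul1r ?mul0r.
rewrite prodb; congr (nat_of_bool _)%:R%R; apply/allP/allP => [h c _|h p pN].
  by apply/allP => p; rewrite mem_filter => /andP[_ /h].
have /h/allP : cls p \in iota 0 (k %/ 2).+1 by rewrite mem_iota add0n ltnS cls_half.
by apply; rewrite mem_filter eqxx.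
Qed.

Lemma opw_mv_classes (R : comNzRingType) (xs : seq R) A :
  opw (mv k) (wordw xs (rev (iota 1 (k * n)) ++ iota 1 (k * n)))
    (fun A => (coreb k (k * n) A)%:R%R) A =
  (\prod_(c <- iota 0 (k %/ 2).+1)
     opw (mv k) (let ps := [seq p <- iota 1 (k * n) | cls p == c] in
                 wordw xs (rev ps ++ ps))
       (fun A => (core_of c A)%:R) A)%R.
Proof.
rewrite (eq_opw _ _ (prod_core_of R)).
rewrite (@opw_factor _ _ _ _ (mv k) cls agree (fun _ => True)) //.
- by apply: eq_bigr => c _; rewrite /= (filter_wordw (fun p => cls p == c)) filter_cat filter_rev.
- by move=> p s s' c _; exact: mv_agree_other.
- by move=> p s t _ _; exact: mv_agree.
- exact: iota_uniq.
- by move=> v _; rewrite mem_iota add0n ltnS cls_half.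
by move=> c s t _ _ st; rewrite (core_of_agree st).
Qed.

Lemma iota_mulS i : iota 1 (k * i.+1) = iota 1 (k * i) ++ iota (k * i).+1 k.
Proof. by rewrite mulnS addnC iotaD add1n. Qed.

End Classes.

(** * The runner of the multiples of [k] *)

Lemma coreb1 n B : 0 \notin B -> (forall q, q \in B -> q <= n) ->
  coreb 1 n B = (B == fset0).
Proof.
move=> B0 Bn; apply/idP/eqP => [/allP noM|->]; last first.
  by apply/allP => p _; rewrite /mv inE.
apply: contrapT => /eqP/fset0Pn ex; case: (ex_minnP ex) => d dB dmin.
have d0 : 0 < d by rewrite lt0n; apply: contraNneq B0 => <-.
have [|B' mB] := mv1_some d0 dB.
  by move=> d1; apply/negP => /dmin; lia.
by have := noM d; rewrite mB mem_iota d0 add1n ltnS Bn // => /(_ isT).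
Qed.

Lemma abacus_runner k p i : 0 < i <= k -> 0 < p -> p = i %[mod k] ->
  p = i + k * ((p - i) %/ k).
Proof.
move=> /andP[i0 ik] p0 pik.
have ip : i <= p.
  case: (ltnP p i) => // pi; move: pik; rewrite (modn_small (leq_trans pi ik)).
  have [ik'|ik'] := eqVneq i k; last by rewrite modn_small; lia.
  by rewrite ik' modnn; lia.
have kd : k %| p - i by rewrite -eqn_mod_dvd // pik.
by rewrite mulnC divnK //; lia.
Qed.

Lemma abacus_mem k la i q : 0 < i <= k -> 0 \notin la ->
  (q \in abacus k la i) = (0 < q) && (i + k * q.-1 \in la).
Proof.
move=> ik la0; apply/mapP/andP => [[p]|[q0 qla]].
  rewrite mem_filter => /andP[/eqP pik pla] ->; rewrite addn1; split=> //=.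
  rewrite -abacus_runner //; rewrite lt0n; by apply: contraNneq la0 => <-.
exists (i + k * q.-1); first by rewrite mem_filter qla andbT addnC mulnC modnMDl.
by rewrite addKn mulKn; lia.
Qed.

Lemma abacus_strict k la i : 0 < i <= k -> strict_partition la ->
  strict_partition (abacus k la i).
Proof.
move=> ik /andP[sla la0]; apply/andP; split; last first.
  by apply/mapP => -[p _]; rewrite addn1.
have gtn_trans : transitive gtn by move=> a b c /= ba ac; exact: ltn_trans ac ba.
rewrite /abacus sorted_map.
have: sorted gtn [seq p <- la | p == i %[mod k]] by apply: sorted_filter.
apply: (@sub_in_sorted _ (fun p => (p == i %[mod k]) && (0 < p))).
  move=> p q /andP[/eqP pi p0] /andP[/eqP qi q0].
  rewrite {1}(abacus_runner ik p0 pi) {1}(abacus_runner ik q0 qi) /= ltn_add2l !addn1.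
  by rewrite ltnS ltn_mul2l => /andP[].
apply/allP => p; rewrite mem_filter => /andP[-> pla] /=.
by rewrite lt0n; apply: contraNneq la0 => <-.
Qed.

Definition runner0 (k : nat) (A : {fset nat}) : {fset nat} :=
  [fset p %/ k | p in A & k %| p].

Lemma mem_runner0 k A q : 0 < k -> (q \in runner0 k A) = (k * q \in A).
Proof.
move=> k0; apply/imfsetP/idP => /= [[p]|qA].
  by rewrite !inE => /andP[pA kp] ->; rewrite mulnC divnK.
by exists (k * q); rewrite ?inE ?qA ?dvdn_mulr ?mulKn.
Qed.

(** A positive multiple of [k] is at least [k], so the double-ribbon case of [mv] does not arise,
    and dividing by [k] turns the other cases into those of [mv 1]. *)
Lemma mv_runner0 k q A : 0 < k -> 0 < q ->
  mv 1 q (runner0 k A) = omap (runner0 k) (mv k (k * q) A).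
Proof.
move=> k0 q0; rewrite /mv mem_runner0 //; case: ifP => //= _.
have -> : (q < 1) = false by lia.
have kq : k <= k * q by rewrite leq_pmulr.
have -> : (k * q < k) = false by rewrite ltnNge kq.
have -> : (k * q == k) = (q == 1) by rewrite -{2}(muln1 k) eqn_pmul2l.
case: eqP => [_|_].
  congr Some; apply/fsetP => e; rewrite !inE !mem_runner0 // !inE.
  by have -> : (k * e == k) = (e == 1) by rewrite -{2}(muln1 k) eqn_pmul2l.
have <- : k * (q - 1) = k * q - k by rewrite mulnBr muln1.
rewrite mem_runner0 //; case: ifP => //= _; congr Some; apply/fsetP => e.
by rewrite !inE !mem_runner0 // !inE !eqn_pmul2l.
Qed.

Lemma filter_cls0 k n : 0 < k ->
  [seq p <- iota 1 (k * n) | cls k p == 0] = [seq k * q | q <- iota 1 n].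
Proof.
move=> k0; apply: (irr_sorted_eq (leT := ltn)).
- exact: ltn_trans.
- exact: ltnn.
- by apply: sorted_filter; [exact: ltn_trans | exact: iota_ltn_sorted].
- rewrite sorted_map; apply: sub_sorted (iota_ltn_sorted 1 n) => a b /=.
  by rewrite ltn_pmul2l.
move=> p; rewrite mem_filter mem_iota; apply/andP/mapP.
  move=> [cp pn]; have kp : k %| p.
    by move: cp; rewrite /cls /dvdn; have := ltn_pmod p k0; lia.
  exists (p %/ k); last by rewrite mulnC divnK.
  rewrite mem_iota divn_gt0 //; have [p0 pkn] := andP pn.
  rewrite (dvdn_leq p0 kp) ltn_divLR //= mulnC; move: pkn; rewrite mulnDr; lia.
move=> [q]; rewrite mem_iota => /andP[q0 qn] ->; split.
  by rewrite /cls mulnC modnMl min0n.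
by rewrite muln_gt0 k0 q0 add1n ltnS leq_pmul2l //; lia.
Qed.

(** Division by [k] turns ribbons on this runner into single cells, and the final core condition
    into emptiness, by [coreb1]. These are the words of the straight Q-function. *)
Lemma opw_class0 m k n la : 0 < k -> strict_partition la ->
    (forall q, q \in la -> q <= k * n) ->
  opw (mv k) (let ps := [seq p <- iota 1 (k * n) | cls k p == 0] in
              wordw (vars m) (rev ps ++ ps))
    (fun A => (core_of k n 0 A)%:R%R) (seq_fsetn la) = Qstrict m (abacus k la k).
Proof.
move=> k0 sla laN; have kk : 0 < k <= k by rewrite k0 leqnn.
have la0 : 0 \notin la by case/andP: sla.
have ab := abacus_strict kk sla; have ab0 : 0 \notin abacus k la k by case/andP: ab.
have run_ab : runner0 k (seq_fsetn la) = seq_fsetn (abacus k la k).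
  apply/fsetP => q; rewrite mem_runner0 // !seq_fsetnE abacus_mem //.
  by case: q => [|q] /=; [rewrite muln0 (negPf la0) | rewrite mulnS].
have nil0 : shdiag [::] = fset0.
  by apply/fsetP => -[c r]; rewrite mem_shdiag // !inE; case: r => //= r; rewrite andbF.
rewrite /Qstrict (@Qskew_opw _ _ [::] (iota 1 n)) //; first last.
- case=> c r; rewrite nil0 fsetD0 mem_shdiag; last by case/andP: ab.
  move=> /and3P[r0 rc]; rewrite mem_iota /diag /= => /(leq_trans r0).
  rewrite -has_count => /hasP [q]; rewrite abacus_mem // => /andP[q0 /laN] qn dq.
  have : q <= n by rewrite -(leq_pmul2l k0) -{1}(prednK q0) mulnS.
  by lia.
- exact: iota_ltn_sorted.
- by rewrite nil0 fsub0set.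
pose I (A : {fset nat}) := 0 \notin A /\ forall q, q \in A -> q <= k * n.
rewrite /= filter_cls0 //.
rewrite (@opw_sim _ _ _ (mv k) _ _ (mv 1) I (runner0 k) (fun p => p %/ k) _ _ _
  (fun B => (coreb 1 n B)%:R%R)).
- rewrite map_cat map_rev -map_comp map_id_in; last by move=> q _ /=; rewrite mulKn.
  rewrite run_ab; apply: (opw_ext_in (I := fun B => 0 \notin B /\ forall q, q \in B -> q <= n)).
  + move=> q B B' _ [B0 Bn] mB; split; first exact: mv0 mB B0.
    exact: mv_bound mB Bn.
  + move=> B [B0 Bn]; rewrite coreb1 //; congr (nat_of_bool (_ == _))%:R%R.
    by apply/fsetP => q; rewrite seq_fsetnE !inE.
  + split; rewrite ?seq_fsetnE // => q; rewrite seq_fsetnE abacus_mem // => /andP[q0 /laN qn].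
    by rewrite -(leq_pmul2l k0) -{1}(prednK q0) mulnS.
- move=> p A A' _ [A0 An] mA; split; first exact: mv0 mA A0.
  exact: mv_bound mA An.
- move=> p A; rewrite mem_cat mem_rev orbb => /mapP [q]; rewrite mem_iota => /andP[q0 _] -> _.
  by rewrite mulKn // mv_runner0.
- move=> A _; congr (nat_of_bool _)%:R%R; rewrite /core_of filter_cls0 // all_map /coreb.
  apply: eq_in_all => q; rewrite mem_iota => /andP[q0 _] /=.
  by rewrite mv_runner0 //; case: (mv k _ A).
by split=> [|q]; rewrite seq_fsetnE //; exact: laN.
Qed.

(** * Maya diagrams *)

Definition maya : Type := int -> bool.

Local Open Scope ring_scope.

Definition mm (j : int) (M : maya) : option maya :=
  if M j && ~~ M (j - 1)
  then Some (fun i => if i == j then false else if i == j - 1 then true else M i)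
  else None.

Lemma mmE j M M' : mm j M = Some M' ->
  [/\ M j, ~~ M (j - 1), M' j = false, M' (j - 1) = true &
      forall i, i != j -> i != j - 1 -> M' i = M i].
Proof.
rewrite /mm; case: ifP => // /andP[Mj Mj1] [<-]; split=> //; rewrite ?eqxx //.
  by have -> : (j - 1 == j) = false by lia.
by move=> i /negPf -> /negPf ->.
Qed.

Lemma mm_sq j M : obind (mm j) (mm j M) = None.
Proof.
case E: (mm j M) => [M'|] //=; have [_ _ M'j _ _] := mmE E.
by rewrite /mm M'j.
Qed.

(** The bead left at [a - 1] by the first move blocks the last one. *)
Lemma mm_braid1 a M : obind (mm a) (obind (mm (a + 1)) (mm a M)) = None.
Proof.
case E: (mm a M) => [M1|] //=; have [_ _ _ M1a _] := mmE E.
case E': (mm (a + 1) M1) => [M2|] //=; have [_ _ _ _ M2E] := mmE E'.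
by rewrite /mm (M2E (a - 1)) ?M1a ?andbF //; lia.
Qed.

(** The first move empties [a + 1], and the second one does not refill it. *)
Lemma mm_braid2 a M : obind (mm (a + 1)) (obind (mm a) (mm (a + 1) M)) = None.
Proof.
case E: (mm (a + 1) M) => [M1|] //=; have [_ _ M1a _ _] := mmE E.
case E': (mm a M1) => [M2|] //=; have [_ _ _ _ M2E] := mmE E'.
by rewrite /mm (M2E (a + 1)) ?M1a //; lia.
Qed.

Definition far (i j : int) : bool := (i + 1 < j) || (j + 1 < i).

Lemma mm_comm i j M : far i j -> obind (mm j) (mm i M) = obind (mm i) (mm j M).
Proof.
move=> ij; have [d1 d2 d3 d4] : [/\ i != j, i - 1 != j, i != j - 1 & i - 1 != j - 1].
  by move: ij; rewrite /far; split; lia.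
rewrite {2}/mm {3}/mm; case: ifP => /= [/andP[Mi Mi1]|Ni].
  rewrite {1}/mm (eq_sym j i) (eq_sym j (i - 1)) (eq_sym (j - 1) i) (eq_sym (j - 1)).
  rewrite (negPf d1) (negPf d2) (negPf d3) (negPf d4).
  case: ifP => //= _; rewrite /mm (negPf d1) (negPf d2) (negPf d3) (negPf d4) Mi Mi1 /=.
  congr Some; apply/funext => e.
  case: (eqVneq e i) => [->|ei]; first by rewrite (negPf d1) (negPf d3).
  case: (eqVneq e (i - 1)) => [->|ei1]; first by rewrite (negPf d2) (negPf d4).
  by [].
case: ifP => //= _; rewrite /mm (negPf d1) (negPf d2) (negPf d3) (negPf d4).
by rewrite Ni.
Qed.

(** * From the fold order to the natural order of positions *)

Section Words.
Variable R : comNzRingType.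

Notation "ps ~~~ qs" := (weq R mm ps qs) (at level 70).

Lemma weq_far i j : far i j -> [:: i; j] ~~~ [:: j; i].
Proof.
move=> ij x f M.
have := opw_letter_sum mm x [:: i; j] f (Some M); rewrite /= => ->.
have := opw_letter_sum mm x [:: j; i] f (Some M); rewrite /= => ->.
by rewrite !big_cons !big_nil /= mm_comm //; ring.
Qed.

(** With [u], [v] the moves at [a], [a + 1], the square of [1 + x v] is [1 + 2 x v]. As [u u] and
    [u v u] vanish, the left product is [1 + 2 x (u + v) + 2 x^2 (u v + v u)], which is symmetric in
    [u] and [v]. *)
Lemma weq_braid a : [:: a; a + 1; a + 1; a] ~~~ [:: a + 1; a; a; a + 1].
Proof.
move=> x f M.
have := opw_letter_sum mm x [:: a; a + 1; a + 1; a] f (Some M); rewrite /= => ->.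
have := opw_letter_sum mm x [:: a + 1; a; a; a + 1] f (Some M); rewrite /= => ->.
rewrite !big_cons !big_nil /=.
rewrite !(mm_sq, mm_braid1, mm_braid2) /=.
have E1 : obind (mm a) (obind (mm (a + 1)) (obind (mm (a + 1)) (mm a M))) = None.
  by case: (mm a M) => [M1|] //=; rewrite mm_sq.
have E2 : obind (mm (a + 1)) (obind (mm a) (obind (mm a) (mm (a + 1) M))) = None.
  by case: (mm (a + 1) M) => [M1|] //=; rewrite mm_sq.
have E3 : obind (mm (a + 1)) (obind (mm (a + 1)) (mm a M)) = None.
  by case: (mm a M) => [M1|] //=; rewrite mm_sq.
have E4 : obind (mm a) (obind (mm a) (mm (a + 1) M)) = None.
  by case: (mm (a + 1) M) => [M1|] //=; rewrite mm_sq.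
by rewrite E1 E2 E3 E4 /=; ring.
Qed.

Lemma weq_move a ps : all (far a) ps -> a :: ps ~~~ ps ++ [:: a].
Proof.
elim: ps => [|p ps IHps] //= /andP[ap aps].
apply: (weq_trans (ps2 := [:: p] ++ (a :: ps))).
  apply: (weq_cat (ps1 := [:: a; p]) (ps1' := [:: p; a]) (ps2 := ps)); last exact: weq_refl.
  exact: weq_far.
by apply: (weq_cat (ps1 := [:: p]) (ps1' := [:: p])); [exact: weq_refl | exact: IHps].
Qed.

Definition asc (a : int) (l : nat) : seq int := [seq a + i%:Z | i <- iota 0 l].

Lemma ascS a l : asc a l.+1 = a :: asc (a + 1) l.
Proof.
rewrite /asc /= addr0 (iotaDl 1 0) -map_comp; congr cons.
by apply: eq_map => i /=; rewrite PoszD addrA.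
Qed.

Lemma asc_cat a l l' : asc a (l + l') = asc a l ++ asc (a + l%:Z) l'.
Proof.
rewrite /asc iotaD map_cat add0n -{2}(addn0 l) iotaDl -map_comp; congr cat.
by apply: eq_map => i /=; rewrite PoszD addrA.
Qed.

Lemma asc_rcons a l : asc a l.+1 = asc a l ++ [:: a + l%:Z].
Proof. by rewrite -addn1 asc_cat /asc /= addr0. Qed.

Lemma mem_asc a l j : (j \in asc a l) = (a <= j < a + l%:Z).
Proof.
apply/mapP/idP => [[i]|h]; first by rewrite mem_iota => h ->; lia.
by exists `|j - a|%N; rewrite ?mem_iota; lia.
Qed.

(** Reverse the part between the two outer copies of [a] by induction; it then has the next position
    [b] twice in its centre. The remaining positions [T] are far from [a], so both copies of [a]
    slide inward to [a b b a], and [weq_braid] turns this into [b a a b]. *)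
Lemma weq_asc a l : asc a l ++ rev (asc a l) ~~~ rev (asc a l) ++ asc a l.
Proof.
elim: l a => [|l IHl] a; first exact: weq_refl.
case: l IHl => [|l] IHl; first by rewrite ascS; exact: weq_refl.
have {IHl} := IHl (a + 1); rewrite [asc a _]ascS [asc (a + 1) _]ascS.
set b := a + 1; set T := asc (b + 1) l => IH.
have aT : all (far a) T.
  by apply/allP => j; rewrite mem_asc /far /b; lia.
apply: (weq_trans (ps2 := [:: a] ++ (rev (b :: T) ++ (b :: T)) ++ [:: a])).
  have -> : (a :: b :: T) ++ rev (a :: b :: T) =
            [:: a] ++ ((b :: T) ++ rev (b :: T)) ++ [:: a].
    by rewrite !rev_cons -!cats1 /= -!catA.
  apply: weq_cat; first exact: weq_refl.
  by apply: weq_cat; [exact: IH | exact: weq_refl].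
have -> : [:: a] ++ (rev (b :: T) ++ b :: T) ++ [:: a] =
    (a :: rev T) ++ [:: b; b] ++ (T ++ [:: a]).
  by rewrite !rev_cons -!cats1 /= -!catA.
apply: (weq_trans (ps2 := (rev T ++ [:: a]) ++ [:: b; b] ++ (a :: T))).
  apply: weq_cat; first by apply: weq_move; rewrite all_rev.
  by apply: weq_cat; [exact: weq_refl | apply: weq_sym; exact: weq_move].
have -> : (rev T ++ [:: a]) ++ [:: b; b] ++ a :: T = rev T ++ [:: a; b; b; a] ++ T.
  by rewrite -!catA.
have -> : rev (a :: b :: T) ++ a :: b :: T = rev T ++ [:: b; a; a; b] ++ T.
  by rewrite !rev_cons -!cats1 /= -!catA.
apply: weq_cat; first exact: weq_refl.
by apply: weq_cat; [exact: weq_braid | exact: weq_refl].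
Qed.

(* The positions of the moves on a pair of runners, by increasing distance
   from the fold: 0, -1, 1, -2, 2, ... on a two-sided diagram and
   -1, -2, ... on a one-sided one. *)
Fixpoint fold_order (two : bool) (n : nat) : seq int :=
  if n is n'.+1 then
    fold_order two n' ++ - n%:Z :: (if two then [:: n%:Z] else [::])
  else if two then [:: 0] else [::].

Lemma fold_order_one n : fold_order false n = rev (asc (- n%:Z) n).
Proof.
elim: n => //= n IHn; rewrite IHn ascS rev_cons -cats1.
by congr (rev (asc _ _) ++ _); lia.
Qed.

(** Negative positions commute with positive ones, even -1 with 1. Only the place of 0 matters, and
    it stays in front. *)
Lemma weq_fold_order n :
  fold_order true n ~~~ [:: 0] ++ rev (asc (- n%:Z) n) ++ asc 1 n.
Proof.
elim: n => [|n IHn]; first exact: weq_refl.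
have -> : [:: 0] ++ rev (asc (- n.+1%:Z) n.+1) ++ asc 1 n.+1 =
    ([:: 0] ++ rev (asc (- n%:Z) n)) ++ (- n.+1%:Z :: asc 1 n) ++ [:: n.+1%:Z].
  rewrite (ascS (- n.+1%:Z)) rev_cons -cats1 (asc_rcons 1) -!catA.
  have -> : - n.+1%:Z + 1 = - n%:Z by lia.
  by have -> : 1 + n%:Z = n.+1%:Z by lia.
apply: (weq_trans (ps2 := ([:: 0] ++ rev (asc (- n%:Z) n) ++ asc 1 n) ++
                          [:: - n.+1%:Z; n.+1%:Z])).
  by apply: weq_cat; [exact: IHn | exact: weq_refl].
have -> : ([:: 0] ++ rev (asc (- n%:Z) n) ++ asc 1 n) ++ [:: - n.+1%:Z; n.+1%:Z] =
   ([:: 0] ++ rev (asc (- n%:Z) n)) ++ (asc 1 n ++ [:: - n.+1%:Z]) ++ [:: n.+1%:Z].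
  by rewrite -!catA.
apply: weq_cat; first exact: weq_refl.
apply: weq_cat; last exact: weq_refl.
apply: weq_sym; apply: weq_move.
by apply/allP => j; rewrite mem_asc /far; lia.
Qed.

Lemma weq_rev_fold_order n :
  rev (fold_order true n) ~~~ rev (asc 1 n) ++ asc (- n%:Z) n ++ [:: 0].
Proof.
elim: n => [|n IHn]; first exact: weq_refl.
have -> : rev (asc 1 n.+1) ++ asc (- n.+1%:Z) n.+1 ++ [:: 0] =
    [:: n.+1%:Z] ++ (rev (asc 1 n) ++ [:: - n.+1%:Z]) ++ (asc (- n%:Z) n ++ [:: 0]).
  rewrite (ascS (- n.+1%:Z)) (asc_rcons 1) rev_cat -!catA.
  have -> : - n.+1%:Z + 1 = - n%:Z by lia.
  by have -> : 1 + n%:Z = n.+1%:Z by lia.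
have -> : rev (fold_order true n.+1) = [:: n.+1%:Z; - n.+1%:Z] ++ rev (fold_order true n).
  by rewrite /= rev_cat.
apply: (weq_trans (ps2 := [:: n.+1%:Z; - n.+1%:Z] ++
   (rev (asc 1 n) ++ asc (- n%:Z) n ++ [:: 0]))).
  by apply: weq_cat; [exact: weq_refl | exact: IHn].
have -> : [:: n.+1%:Z; - n.+1%:Z] ++ rev (asc 1 n) ++ asc (- n%:Z) n ++ [:: 0] =
  [:: n.+1%:Z] ++ (- n.+1%:Z :: rev (asc 1 n)) ++ (asc (- n%:Z) n ++ [:: 0]).
  by [].
apply: weq_cat; first exact: weq_refl.
apply: weq_cat; last exact: weq_refl.
by apply: weq_move; apply/allP => j; rewrite mem_rev mem_asc /far; lia.
Qed.

(** After sorting each pass, the two copies of 0 meet in the middle, between an ascending and a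
    descending run from [-n] to [-1]. [weq_asc] reverses that middle part, and the outer runs of
    positive positions are already in order. *)
Lemma weq_fold (two : bool) n :
  let positions := asc (- n%:Z) (n + (if two then n.+1 else 0)) in
  rev (fold_order two n) ++ fold_order two n ~~~ rev positions ++ positions.
Proof.
case: two => /=; last by rewrite addn0 fold_order_one revK; exact: weq_asc.
have -> : asc (- n%:Z) (n + n.+1) = asc (- n%:Z) n.+1 ++ asc 1 n.
  by rewrite addnS -addSn asc_cat; congr (_ ++ asc _ _); lia.
apply: (weq_trans (ps2 := (rev (asc 1 n) ++ asc (- n%:Z) n ++ [:: 0]) ++
                         ([:: 0] ++ rev (asc (- n%:Z) n) ++ asc 1 n))).
  by apply: weq_cat; [exact: weq_rev_fold_order | exact: weq_fold_order].
have ascE : asc (- n%:Z) n.+1 = asc (- n%:Z) n ++ [:: 0].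
  by rewrite asc_rcons; congr (_ ++ [:: _]); lia.
have -> : (rev (asc 1 n) ++ asc (- n%:Z) n ++ [:: 0]) ++
    [:: 0] ++ rev (asc (- n%:Z) n) ++ asc 1 n =
    rev (asc 1 n) ++ (asc (- n%:Z) n.+1 ++ rev (asc (- n%:Z) n.+1)) ++ asc 1 n.
  by rewrite ascE rev_cat /= -!catA.
have -> : rev (asc (- n%:Z) n.+1 ++ asc 1 n) ++ asc (- n%:Z) n.+1 ++ asc 1 n =
    rev (asc 1 n) ++ (rev (asc (- n%:Z) n.+1) ++ asc (- n%:Z) n.+1) ++ asc 1 n.
  by rewrite rev_cat -!catA.
apply: weq_cat; first exact: weq_refl.
by apply: weq_cat; [exact: weq_asc | exact: weq_refl].
Qed.

Lemma mem_fold_order (two : bool) n j :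
  (j \in fold_order two n) = (j \in asc (- n%:Z) (n + (if two then n.+1 else 0))).
Proof.
rewrite mem_asc; elim: n => [|n IHn] /=; first by case: two; rewrite inE; lia.
by rewrite mem_cat IHn inE; case: two {IHn} => /=; rewrite inE; lia.
Qed.

End Words.

Local Close Scope ring_scope.

(** * Folded diagrams *)

(** The [size s - i] parts from index [i] on are distinct and exceed 1. *)
Lemma nth_strict_lower (s : seq nat) i : sorted gtn s -> {in s, forall p, 1 < p} ->
  i < size s -> size s - i < nth 0 s i.
Proof.
elim: s i => // a s IHs [|i] ss s1 il; last first.
  rewrite /= subSS; apply: IHs => //; first exact: path_sorted ss.
  by move=> p ps; apply: s1; rewrite inE ps orbT.
have a1 : 1 < a by apply: s1; rewrite mem_head.
case: s ss s1 IHs {il} => [|b s] //= /andP[ba ss] s1 IHs.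
have := IHs 0 ss; rewrite /= subn0 => h; apply: leq_trans ba; rewrite ltnS.
by apply: h => // p ps; apply: s1; rewrite inE ps orbT.
Qed.

Lemma mem_young ga c r :
  ((c, r) \in young_diagram ga) = [&& 0 < r, 0 < c & c <= nth 0 ga r.-1].
Proof.
rewrite inE /=; apply/allpairsPdep/and3P => /=.
  by move=> [r' [c' []]]; rewrite !mem_iota => /andP[r0 rs] cr [-> ->]; split; lia.
move=> [r0 c0 h]; exists r, c; rewrite !mem_iota; split=> //; last by lia.
by case: (ltnP r.-1 (size ga)) => [|l]; [lia | move: h; rewrite nth_default //; lia].
Qed.

Lemma young_inj ga ga' : partition_seq ga -> partition_seq ga' ->
  young_diagram ga = young_diagram ga' -> ga = ga'.
Proof.
move=> /andP[_ ga0] /andP[_ ga'0] E.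
have nthE i : nth 0 ga i = nth 0 ga' i.
  have le x y : young_diagram x = young_diagram y -> nth 0 x i <= nth 0 y i.
    move=> xy; case c: (nth 0 x i) => [//|c'].
    have : (c'.+1, i.+1) \in young_diagram x by rewrite mem_young /= c.
    by rewrite xy mem_young => /and3P[].
  by apply/eqP; rewrite eqn_leq !le.
have le x y : 0 \notin y -> (forall i, nth 0 x i = nth 0 y i) -> size y <= size x.
  move=> y0 xy; rewrite leqNgt; apply/negP => xy'.
  have := mem_nth 0 xy'; rewrite -xy nth_default // => h.
  by rewrite h in y0.
by apply: (@eq_from_nth _ 0) => //; apply/eqP; rewrite eqn_leq !le.
Qed.

(** A nonempty Young diagram has [(1, 1)] as its lower left corner, which fixes the translation. The
    empty diagram is treated apart, as every vector translates it to itself. *)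
Lemma translate_unique C ga ga' : partition_seq ga -> partition_seq ga' ->
  is_translate C (young_diagram ga) -> is_translate C (young_diagram ga') -> ga = ga'.
Proof.
have corner x : partition_seq x -> x != [::] -> (1, 1) \in young_diagram x.
  by case: x => //= a x /andP[_]; rewrite inE negb_or mem_young /= => /andP[a0 _] _; rewrite lt0n eq_sym.
have le (D D' : diagram) (u v u' v' : int) : (forall x, x \in D -> 0 < x.1 /\ 0 < x.2) -> (1, 1) \in D' ->
    [fset ((x.1%:Z + u)%R, (x.2%:Z + v)%R) | x in D] =
    [fset ((x.1%:Z + u')%R, (x.2%:Z + v')%R) | x in D'] -> (u <= u')%R /\ (v <= v')%R.
  move=> D0 D'1 E; have : ((1%:Z + u')%R, (1%:Z + v')%R) \in
      [fset ((x.1%:Z + u)%R, (x.2%:Z + v)%R) | x in D].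
    by rewrite E; apply/imfsetP; exists (1, 1).
  by case/imfsetP => -[c r] /= /D0 [/= x1 x2] [E1 E2]; split; lia.
have y0 x z : z \in young_diagram x -> 0 < z.1 /\ 0 < z.2.
  by case: z => c r; rewrite mem_young => /and3P[].
move=> pga pga' [u [v Cga]] [u' [v' Cga']]; rewrite Cga in Cga'.
have nilP x x' a b a' b' : partition_seq x' ->
   [fset ((y.1%:Z + a)%R, (y.2%:Z + b)%R) | y in young_diagram x] =
   [fset ((y.1%:Z + a')%R, (y.2%:Z + b')%R) | y in young_diagram x'] ->
   x = [::] -> x' = [::].
  move=> px' E x0; apply: contrapT => /eqP/(corner _ px') x'1.
  have : ((1%:Z + a')%R, (1%:Z + b')%R) \in
      [fset ((y.1%:Z + a)%R, (y.2%:Z + b)%R) | y in young_diagram x].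
    by rewrite E; apply/imfsetP; exists (1, 1).
  by case/imfsetP => -[c r] /=; rewrite x0 mem_young nth_nil; lia.
have [ga0|ga0] := eqVneq ga [::]; first by rewrite ga0 (nilP _ _ _ _ _ _ pga' Cga' ga0).
have ga'0 : ga' != [::] by apply: contraNneq ga0 => /(nilP _ _ _ _ _ _ pga (esym Cga')) ->.
have [uu vv] := le _ _ _ _ _ _ (y0 ga) (corner _ pga' ga'0) Cga'.
have [u'u v'v] := le _ _ _ _ _ _ (y0 ga') (corner _ pga ga0) (esym Cga').
have ? : u' = u by lia.
have ? : v' = v by lia.
subst u' v'; apply: young_inj => //; apply/fsetP => z.
have inj : injective (fun x : cell => ((x.1%:Z + u)%R, (x.2%:Z + v)%R)).
  by move=> [c r] [c' r'] /= [E1 E2]; congr pair; lia.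
by move/fsetP/(_ ((z.1%:Z + u)%R, (z.2%:Z + v)%R)): Cga'; rewrite !(mem_imfset _ _ inj).
Qed.

(* The partition with bead positions B; position 0 is the last one below the
   first hole, which is at position 1. *)
Definition bead_partition (B : {fset nat}) : seq nat :=
  let s := sort geq B in mkseq (fun i => nth 0 s i - (size s - i)) (size s).

Section BeadPartition.
Variable B : {fset nat}.
Hypothesis B1 : forall p, p \in B -> 1 < p.

Let s := sort geq B.
Let ss : sorted gtn s. Proof. exact: sort_fset_sorted. Qed.
Let s1 : {in s, forall p, 1 < p}.
Proof. by move=> p; rewrite mem_sort => /B1. Qed.

Lemma plus_delta_bead_partition : plus_delta (bead_partition B) = s.
Proof.
rewrite /plus_delta size_mkseq -/s; apply: (@eq_from_nth _ 0); rewrite size_mkseq // => i il.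
by rewrite !nth_mkseq // subnK // ltnW // nth_strict_lower.
Qed.

Lemma bead_partition_partition : partition_seq (bead_partition B).
Proof.
apply/andP; split; last first.
  apply/mapP => -[i]; rewrite mem_iota => /andP[_ il].
  by have := nth_strict_lower ss s1 il; rewrite -/s; lia.
apply/(sortedP 0) => i; rewrite size_mkseq => il; rewrite /= !nth_mkseq ?(ltnW il) //.
have := sortedP 0 ss i il; have := nth_strict_lower ss s1 il; rewrite -/s /=; lia.
Qed.

Lemma size_sort_fset : size s = cnt 1 B.
Proof.
rewrite size_sort cnt_enum; apply/esym/eqP; rewrite -all_count.
by apply/allP => p /B1; lia.
Qed.

(** Removing the staircase of length [cnt 1 B] shifts columns by that number: [(c, r)] corresponds
    to the cell [(c + cnt 1 B, r)] of the shifted shape, whose diagonal appears on the right. *)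
Lemma mem_young_bead_partition c r : ((c, r) \in young_diagram (bead_partition B)) =
  [&& 0 < r, 0 < c, r <= c + cnt 1 B & r <= cnt (c + cnt 1 B - r + 1) B].
Proof.
rewrite mem_young -size_sort_fset; case: (posnP r) => //= r0; case: (posnP c) => //= c0.
have [rl|rl] := ltnP r.-1 (size s); last first.
  rewrite nth_default ?size_mkseq // leqNgt c0; apply/esym/negbTE; apply/negP => /andP[rc].
  have := @cnt_le 1 (c + size s - r + 1) B; rewrite -size_sort_fset; lia.
rewrite nth_mkseq // -/s.
have -> : r <= cnt (c + size s - r + 1) B = (r.-1 < count (leq (c + size s - r + 1)) s).
  rewrite prednK // cnt_enum; congr (_ <= _); apply/esym/permP; by rewrite perm_sort.
rewrite -nth_count_leq //; last by lia.
by have := nth_strict_lower ss s1 rl; lia.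
Qed.

End BeadPartition.

(** [al] is complemented and read backwards: lowering a part of [al] by 1 lowers a Maya bead by 1
    too, and deleting the part 1 of both partitions moves the bead 0 to -1. *)
Definition two_runner_maya (al be : seq nat) : maya := fun j =>
  match j with Posz i => i.+1 \in be | Negz i => i.+1 \notin al end.

(** [h] will be the lowest hole and is numbered 1; the window of length [P] keeps the set finite. *)
Definition beads_above (h : int) (P : nat) (M : maya) : {fset nat} :=
  [fset p in iota 1 P | M (h - 1 + p%:Z)%R].

Lemma mem_beads_above h P M p :
  (p \in beads_above h P M) = [&& 0 < p, p <= P & M (h - 1 + p%:Z)%R].
Proof. by rewrite !inE /= mem_iota add1n ltnS andbA. Qed.

Lemma beads_above_gt1 h P M p : ~~ M h -> p \in beads_above h P M -> 1 < p.
Proof.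
move=> hole; rewrite mem_beads_above => /and3P[p0 _].
by case: (eqVneq p 1) => [->|]; [rewrite subrK (negPf hole) | lia].
Qed.

Lemma cnt_seq_fsetn (la : seq nat) d : strict_partition la ->
  cnt d (seq_fsetn la) = count (leq d) la.
Proof.
move=> /andP[sla _]; rewrite cnt_enum; apply/permP/uniq_perm.
- exact: fset_uniq.
- exact: gtn_sorted_uniq.
by move=> x; exact: (seq_fsetnE la x).
Qed.

Lemma cnt1_seq_fsetn (la : seq nat) : strict_partition la -> cnt 1 (seq_fsetn la) = size la.
Proof.
move=> sla; rewrite cnt_seq_fsetn //; apply/eqP; rewrite -all_count.
apply/allP => p pla; rewrite lt0n; case/andP: sla => _; by apply: contraNneq => <-.
Qed.

(** * The folded diagram as the Young diagram of a Maya diagram *)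

Section Folding.
Variables (al be : seq nat) (h : int) (N P : nat).
Hypotheses (sal : strict_partition al) (sbe : strict_partition be).
Hypotheses (alN : forall q, q \in al -> q <= N) (beN : forall q, q \in be -> q <= N).

Let M := two_runner_maya al be.
Hypotheses (hole : ~~ M h) (below : forall j, (j < h)%R -> M j).
Hypothesis PN : (N%:Z <= h - 1 + P%:Z)%R.

Let B := beads_above h P M.
Let AL := seq_fsetn al.
Let BE := seq_fsetn be.

(* The number of beads at positions t, t+1, ... *)
Definition beads_from (t : int) : int :=
  match t with
  | Posz i => (cnt i.+1 BE)%:Z
  | Negz i => ((size be)%:Z + i.+1%:Z - (size al)%:Z + (cnt i.+2 AL)%:Z)%R
  end.

Lemma beads_fromS t : beads_from t = (beads_from (t + 1) + (M t)%:Z)%R.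
Proof.
case: t => [i|[|i]].
- have -> : (Posz i + 1)%R = i.+1 by lia.
  by rewrite /= (cntS i.+1) seq_fsetnE PoszD.
- have -> : (Negz 0 + 1)%R = 0 by lia.
  rewrite /= -(cnt1_seq_fsetn sal) -(cnt1_seq_fsetn sbe) -/AL -/BE (cntS 1 AL) seq_fsetnE.
  by case: (1 \in al) => /=; lia.
- have -> : (Negz i.+1 + 1)%R = Negz i by lia.
  rewrite /= (cntS i.+2 AL) seq_fsetnE.
  by case: (i.+2 \in al) => /=; lia.
Qed.

Lemma cnt_beads_above d : 0 < d -> Posz (cnt d B) = beads_from (h - 1 + d%:Z)%R.
Proof.
have far e : P < e -> Posz (cnt e B) = beads_from (h - 1 + e%:Z)%R.
  move=> Pe; have -> : cnt e B = 0.
    rewrite cnt_enum; apply/eqP; rewrite -leqn0 leqNgt -has_count; apply/hasPn => p.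
    by rewrite -[p \in _]/(p \in B) mem_beads_above; lia.
  have [i [iE iN]] : exists i, (h - 1 + e%:Z)%R = Posz i.+1 /\ N <= i.+1.
    by exists (absz (h - 1 + e%:Z - 1)%R); lia.
  rewrite iE /=; congr Posz; apply/esym.
  rewrite cnt_enum; apply/eqP; rewrite -leqn0 leqNgt -has_count; apply/hasPn => p.
  by rewrite -[p \in _]/(p \in BE) seq_fsetnE => /beN; lia.
move=> d0; case: (ltnP P d) => [|dP]; first exact: far.
have [e dE] : exists e, d + e = P.+1 by exists (P.+1 - d); lia.
elim: e d d0 dE {dP} => [|e IHe] d d0 dE; first by apply: far; lia.
rewrite cntS beads_fromS PoszD (IHe d.+1) ?addSnnS //.
have -> : (h - 1 + d%:Z + 1)%R = (h - 1 + d.+1%:Z)%R by lia.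
congr (_ + Posz _)%R; rewrite mem_beads_above d0.
by have -> : d <= P by lia.
Qed.

Lemma beads_from_below i : beads_from (h - i%:Z)%R = (i%:Z + beads_from h)%R.
Proof.
elim: i => [|i IHi]; first by rewrite subr0 add0r.
rewrite beads_fromS below; last by lia.
have -> : (h - i.+1%:Z + 1)%R = (h - i%:Z)%R by lia.
by rewrite IHi; lia.
Qed.

Lemma cnt1_beads_above : Posz (cnt 1 B) = beads_from h.
Proof. by rewrite cnt_beads_above // subrK. Qed.

(** The beads from a position far to the left are counted twice: once by the two runners, once by
    using that everything below [h] is filled. *)
Lemma charge : (h + (cnt 1 B)%:Z = (size be)%:Z - (size al)%:Z)%R.
Proof.
rewrite cnt1_beads_above.
(* The position [Negz e] lies below [h] and beyond all parts of [al]. *)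
pose e := N + absz h; have := beads_from_below (absz (h + e.+1%:Z)%R).
have -> : (h - (absz (h + e.+1%:Z)%R)%:Z)%R = Negz e by rewrite /e NegzE; lia.
have -> /= : beads_from (Negz e) = ((size be)%:Z + e.+1%:Z - (size al)%:Z)%R.
  rewrite /=; have -> : cnt e.+2 AL = 0; last by rewrite addr0.
  rewrite cnt_enum; apply/eqP; rewrite -leqn0 leqNgt -has_count; apply/hasPn => p.
  by rewrite -[p \in _]/(p \in AL) seq_fsetnE => /alN; rewrite /e; lia.
by rewrite /e; lia.
Qed.

(** The charge translates numbers counted from the hole into positions, so only the content [c - r]
    enters. Where the subtraction of naturals would truncate, [beads_from_below] shows that both
    sides are false. *)
Lemma mem_young_beads c r : ((c, r) \in young_diagram (bead_partition B)) =
  [&& 0 < r, 0 < c & (r%:Z <= beads_from (c%:Z - r%:Z + (size be)%:Z - (size al)%:Z))%R].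
Proof.
rewrite mem_young_bead_partition; last by move=> p; exact: beads_above_gt1.
case: (posnP r) => //= r0; case: (posnP c) => //= c0.
have ch := charge; have [rl|rl] /= := leqP r (c + cnt 1 B).
  have d0 : 0 < c + cnt 1 B - r + 1 by lia.
  rewrite -lez_nat cnt_beads_above //; congr (_ <= beads_from _)%R; lia.
have := beads_from_below (r - (c + cnt 1 B)); rewrite -cnt1_beads_above.
have -> : (h - (r - (c + cnt 1 B))%N%:Z)%R = (c%:Z - r%:Z + (size be)%:Z - (size al)%:Z)%R by lia.
by move=> ->; lia.
Qed.

(** Contents at least 0 are governed by [be] and contents at most 0 by the reflected [al]; on the
    fold line both give the same cells. *)
Lemma combination_translate :
  is_translate (combination al be).1 (young_diagram (bead_partition B)).
Proof.
rewrite /is_translate /combination /=.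
set a := size al; set b := size be; set n := minn a b.
have nab : [/\ n <= a, n <= b & (n == a) || (n == b)] by rewrite /n; split; lia.
case: nab; move: n => n na nb nE.
have AL_sh c r : ((c, r) \in shdiag al) = [&& 0 < r, r <= c & r <= cnt (c - r + 1) AL].
  by case/andP: sal => sal' _; rewrite shdiag_sh // mem_sh.
have BE_sh c r : ((c, r) \in shdiag be) = [&& 0 < r, r <= c & r <= cnt (c - r + 1) BE].
  by case/andP: sbe => sbe' _; rewrite shdiag_sh // mem_sh.
move: (shdiag al) (shdiag be) AL_sh BE_sh => SA SB AL_sh BE_sh.
have bf_pos t : beads_from (Posz t) = Posz (cnt (t + 1) BE) by rewrite addn1.
have bf_neg s : beads_from (- s%:Z)%R = (b%:Z + s%:Z - a%:Z + (cnt (s + 1) AL)%:Z)%R.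
  case: s => [|s]; last by rewrite -NegzE addn1.
  by rewrite oppr0 /= add0n (cnt1_seq_fsetn sal) (cnt1_seq_fsetn sbe); lia.
(* One of the two shifts is 0. This translation turns [c - r] into [c - r + b - a], so the fold line
   becomes the content at which the runners meet. *)
exists (- (a - n)%N%:Z)%R, (- (b - n)%N%:Z)%R; apply/fsetP => z; apply/fsetUP/imfsetP.
  case=> /imfsetP [[c r]] /=; rewrite !inE /= ?AL_sh ?BE_sh => /andP[/and3P[r0 rc rA] cn] ->.
    exists (r, c + (b - n) - (a - n)); last by congr pair; rewrite /=; lia.
    rewrite mem_young_beads.
    have -> : (r%:Z - (c + (b - n) - (a - n))%N%:Z + (size be)%:Z - (size al)%:Z =
               - (c - r)%N%:Z)%R by rewrite -/a -/b; lia.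
    by rewrite bf_neg; lia.
  exists (c + (a - n) - (b - n), r); last by congr pair; rewrite /=; lia.
  rewrite mem_young_beads.
  have -> : ((c + (a - n) - (b - n))%N%:Z - r%:Z + (size be)%:Z - (size al)%:Z =
               (c - r)%N%:Z)%R by rewrite -/a -/b; lia.
  by rewrite bf_pos; lia.
case=> -[c r] /=; rewrite mem_young_beads -/a -/b => /and3P[r0 c0].
have [t0|t0] : (0 <= c%:Z - r%:Z + b%:Z - a%:Z)%R \/ (c%:Z - r%:Z + b%:Z - a%:Z < 0)%R by lia.
  have [t tE] : exists t : nat, (c%:Z - r%:Z + b%:Z - a%:Z = t%:Z)%R.
    by exists (absz (c%:Z - r%:Z + b%:Z - a%:Z)%R); lia.
  rewrite tE bf_pos => rB ->; right; apply/imfsetP; exists (r + t, r); last by congr pair; rewrite /=; lia.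
  rewrite !inE /= BE_sh r0 leq_addr; have -> : r + t - r + 1 = t + 1 by lia.
  by lia.
have [s tE] : exists s : nat, (c%:Z - r%:Z + b%:Z - a%:Z = - s%:Z)%R.
  by exists (absz (c%:Z - r%:Z + b%:Z - a%:Z)%R); lia.
rewrite tE bf_neg => rA ->; left; apply/imfsetP; exists (c + s, c); last by congr pair; rewrite /=; lia.
rewrite !inE /= AL_sh c0 leq_addr; have -> : c + s - c + 1 = s + 1 by lia.
by lia.
Qed.

Lemma underlying_shape_combination :
  underlying_shape (combination al be) = bead_partition B.
Proof.
have p : partition_seq (bead_partition B).
  by apply: bead_partition_partition; by move=> p; exact: beads_above_gt1.
apply: xget_unique; first by split=> //; exact: combination_translate.
by move=> ga [pga tga]; apply: translate_unique tga combination_translate.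
Qed.

End Folding.

Lemma cnt_closed B : (forall d, 0 < d -> d.+1 \in B -> d \in B) ->
  forall d, 0 < d -> cnt d B = (cnt 1 B).+1 - d.
Proof.
move=> closed d; case: d => // d _; elim: d => [|d IHd]; first by rewrite subn1.
have := cntS d.+1 B; rewrite IHd.
case: (posnP (cnt d.+2 B)) => [->|]; first by case: (_ \in B) => /=; lia.
rewrite {1}cnt_enum -has_count => /hasP [q qB dq].
have -> : d.+1 \in B; last by lia.
have [e qE] : exists e, q = d.+1 + e by exists (q - d.+1); lia.
rewrite {}qE {dq} in qB; elim: e qB => [|e IHe]; first by rewrite addn0.
by rewrite addnS => /closed h; apply/IHe/h.
Qed.

Lemma mem_delta l q : (q \in delta l) = (0 < q <= l).
Proof.
apply/mapP/idP => [[i]|h]; first by rewrite mem_iota => h ->; lia.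
by exists (l - q); rewrite ?mem_iota; lia.
Qed.

Lemma delta_strict l : strict_partition (delta l).
Proof.
rewrite /strict_partition mem_delta andbT.
apply/(sortedP 0) => i; rewrite size_mkseq => il.
by rewrite !nth_mkseq ?(ltnW il) //=; lia.
Qed.

Lemma cnt_delta l d : 0 < d -> cnt d (seq_fsetn (delta l)) = l.+1 - d.
Proof.
move=> d0; rewrite cnt_closed // ?cnt1_seq_fsetn ?delta_strict ?size_mkseq //.
by move=> e e0; rewrite !seq_fsetnE !mem_delta; lia.
Qed.

(** * Maya diagrams as skew-shifted shapes *)

Section MayaToShifted.
Variables (m n L P : nat) (h : int) (M0 : maya).
Let X := asc (- n%:Z)%R L.
Hypotheses (hole : ~~ M0 h) (below : forall j, (j < h)%R -> M0 j).
Hypotheses (above : forall j, (- n%:Z + L%:Z <= j)%R -> ~~ M0 j).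
Hypotheses (hn : (- n.+1%:Z <= h)%R) (hP : (L%:Z <= n%:Z + h - 1 + P%:Z)%R).

Let psi := beads_above h P.
Let l := cnt 1 (psi M0).

(** Moves keep everything below [h] filled, stay inside the window and conserve the number of beads;
    so [l] is the number of parts of both the outer and the inner shape. *)
Let inv (M : maya) := [/\ forall j, (j < h)%R -> M j,
  forall j, (- n%:Z + L%:Z <= j)%R -> ~~ M j & cnt 1 (psi M) = l].

Let mem_psi M p : (p \in psi M) = [&& 0 < p, p <= P & M (h - 1 + p%:Z)%R].
Proof. exact: mem_beads_above. Qed.

Let psi_above M p : inv M -> p \in psi M -> (h - 1 + p%:Z < - n%:Z + L%:Z)%R.
Proof.
move=> [_ ab _]; rewrite mem_psi => /and3P[_ _ Mp].
have [//|h'] : (h - 1 + p%:Z < - n%:Z + L%:Z)%R \/ (- n%:Z + L%:Z <= h - 1 + p%:Z)%R by lia.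
by have := ab _ h'; rewrite Mp.
Qed.

(** The target [j - 1] lies below [h] and is occupied. *)
Let mm_low M j : inv M -> (j <= h)%R -> mm j M = None.
Proof.
by move=> [be _ _] jh; rewrite /mm [M (j - 1)%R]be ?andbF //; lia.
Qed.

Let mm_psi M j : j \in X -> (h < j)%R ->
  mv 1 (absz (j - h + 1)%R) (psi M) = omap psi (mm j M).
Proof.
rewrite mem_asc => jX hj; set d := absz _.
have dE : j = (h - 1 + d%:Z)%R by rewrite /d; lia.
have dP : d <= P by lia.
have d1 : 1 < d by lia.
rewrite /mv mem_psi -dE dP; have -> : 0 < d by lia.
have -> : (d < 1) = false by lia.
have -> : (d == 1) = false by lia.
rewrite /mm /=; case: (M j) => //=.
have d1E : (h - 1 + (d - 1)%N%:Z = j - 1)%R by lia.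
rewrite mem_psi d1E; have -> : 0 < d - 1 by lia.
have -> : d - 1 <= P by lia.
case: (M (j - 1)%R) => //=; congr Some; apply/fsetP => p.
rewrite in_fset1U in_fsetD1 !mem_psi.
case: (eqVneq p (d - 1)) => [->|pd1] /=.
  rewrite d1E eqxx; have -> : (j - 1 == j)%R = false by lia.
  have -> : 0 < d - 1 by lia.
  by have -> : d - 1 <= P by lia.
case: (eqVneq p d) => [->|pd] /=; first by rewrite -dE eqxx !andbF.
have -> : (h - 1 + p%:Z == j)%R = false by lia.
by have -> : (h - 1 + p%:Z == j - 1)%R = false by lia.
Qed.

Let inv_mm M M' j : j \in X -> inv M -> mm j M = Some M' -> inv M'.
Proof.
move=> jX iM mj; have [be ab cM] := iM.
have hj : (h < j)%R.
  have [//|h'] : (h < j)%R \/ (j <= h)%R by lia.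
  by rewrite mm_low in mj.
have [Mj Mj1 M'j M'j1 M'E] := mmE mj; split.
- move=> i ih; have [->//|ij] := eqVneq i (j - 1)%R.
  by rewrite M'E ?be //; lia.
- move=> i ih; have ij : i != j.
    by apply: contraTneq Mj => <-; exact: ab.
  by rewrite M'E ?ab //; move: jX; rewrite mem_asc; lia.
have := mm_psi M jX hj; rewrite mj /= => /mv1_cnt [_ /(_ 1 isT)].
have -> : (1 == absz (j - h + 1)%R) = false by lia.
by rewrite cM addn0.
Qed.

(** If nothing moves, there is no gap below a bead, so the [l] beads have the numbers 1 to [l].
    Conversely a packed diagram has no free target. *)
Let core_psi M : inv M ->
  all (fun j => ~~ mm j M) X = (psi M == seq_fsetn (delta l)).
Proof.
move=> iM; have [be ab cM] := iM; apply/allP/eqP => [noM|psiE j jX].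
  have closed d : 0 < d -> d.+1 \in psi M -> d \in psi M.
    move=> d0 dM; apply: contrapT => /negP ndM.
    have := psi_above iM dM; move: dM ndM; rewrite !mem_psi => /and3P[_ dP MdS] Md da.
    have jX : (h - 1 + d.+1%:Z)%R \in X by rewrite mem_asc; lia.
    have := noM _ jX; rewrite /mm MdS.
    have -> : (h - 1 + d.+1%:Z - 1 = h - 1 + d%:Z)%R by lia.
    by move: Md; rewrite d0 (ltnW dP) /= => ->.
  apply: cnt_eq; rewrite ?mem_psi ?seq_fsetnE ?mem_delta // => d d0.
  by rewrite cnt_closed // cM cnt_delta.
have [hj|hj] : (j <= h)%R \/ (h < j)%R by lia.
  by rewrite mm_low.
have := mm_psi M jX hj; rewrite psiE /mv; set d := absz _.
have d1 : 1 < d by rewrite /d; lia.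
have -> : (d < 1) = false by lia.
have -> : (d == 1) = false by lia.
rewrite !seq_fsetnE !mem_delta; case: (mm j M) => //= M'.
case: ifP => // /negbFE dl.
by have -> : 0 < d - 1 <= l by lia.
Qed.

Lemma opw_maya :
  opw mm (wordw (vars m) (rev X ++ X)) (fun M => (all (fun j => ~~ mm j M) X)%:R%R) M0 =
  Qpartition m (bead_partition (psi M0)).
Proof.
have B1 p : p \in psi M0 -> 1 < p.
  exact: beads_above_gt1.
have i0 : inv M0 by split.
have lE : size (bead_partition (psi M0)) = l by rewrite size_mkseq size_sort_fset.
have Xx j : j \in rev X ++ X -> j \in X by rewrite mem_cat mem_rev orbb.
(* Positions up to [h] have to go before the passage to [mv 1], which would delete a bead numbered 1
   where the Maya diagram blocks it. *)
rewrite (@opw_drop _ _ _ mm inv (fun j => h < j)%R); first last.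
- exact: i0.
- by move=> j M _ /= hj iM; apply: mm_low => //; lia.
- by move=> j M M' /Xx; exact: inv_mm.
rewrite (@opw_sim _ _ _ mm _ _ (mv 1) inv psi (fun j => absz (j - h + 1)%R) _ _ _
  (fun B => (B == seq_fsetn (delta l))%:R%R)) //; first last.
- by move=> M iM; rewrite core_psi.
- by move=> j M; rewrite mem_filter => /andP[hj /Xx jX] _; exact: mm_psi.
- by move=> j M M'; rewrite mem_filter => /andP[_ /Xx]; exact: inv_mm.
rewrite filter_cat filter_rev map_cat map_rev.
have sB := sort_fset_sorted (psi M0).
have spB : strict_partition (sort geq (psi M0)).
  by rewrite /strict_partition sB mem_sort; apply/negP => /B1.
rewrite /Qpartition (plus_delta_bead_partition B1) lE.
set ds := map _ _; rewrite (@Qskew_opw _ _ _ ds) //.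
- congr (opw _ _ _ _); apply/fsetP => p; by rewrite seq_fsetnE mem_sort.
- exact: delta_strict.
- rewrite !shdiag_sh //; last by case/andP: (delta_strict l).
  apply: sh_sub => d d0; rewrite cnt_delta //.
  have -> : seq_fsetn (sort geq (psi M0)) = psi M0.
    by apply/fsetP => p; rewrite seq_fsetnE mem_sort.
  by have := cnt_le_sub (psi M0) d0; rewrite -/l; lia.
- rewrite sorted_map; apply: (@sub_in_sorted _ (fun j => h < j)%R (fun i j => (i < j)%R)).
  + by move=> i j /= hi hj; lia.
  + exact: filter_all.
  + apply: sorted_filter; first by move=> a b c /=; lia.
    rewrite sorted_map; apply: sub_sorted (iota_ltn_sorted 0 L) => a b /=; lia.
have -> : shdiag (sort geq (psi M0)) = sh (psi M0) by rewrite shE.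
rewrite shdiag_sh; last by case/andP: (delta_strict l).
case=> c r; rewrite mem_skew /diag /= => /and4P[r0 rc rA rB].
set d := c - r + 1 in rA rB *; have d0 : 0 < d by rewrite /d; lia.
rewrite cnt_delta // in rB.
(* Both shapes have [l] cells on the diagonal 1, so the skew shape has none there. This matches the
   positions kept, which lie strictly above [h]. *)
have d1 : d != 1.
  by apply/eqP => d1; move: rA; rewrite d1 -/l; lia.
have : 0 < cnt d (psi M0) by apply: leq_trans rA.
rewrite cnt_enum -has_count => /hasP [q qM dq].
have qa := psi_above i0 qM.
apply/mapP; exists (h - 1 + d%:Z)%R; last by lia.
by rewrite mem_filter mem_asc; lia.
Qed.

End MayaToShifted.

(** * Pairs of runners *)

Section PairOfRunners.
Variables (k c : nat).
Hypotheses (c0 : 0 < c) (ck : c.*2 <= k).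

Let two := c.*2 < k.

Definition runners_maya (A : {fset nat}) : maya := fun j =>
  match j with
  | Posz i => (c.*2 < k) && (k - c + k * i \in A)
  | Negz i => c + k * i \notin A
  end.

(** A ribbon bead going from [c + k * i.+1] to [c + k * i] is seen through the gaps: the Maya bead
    at [Negz i] moves to [Negz i.+1]. *)
Definition runner_position (p : nat) : int :=
  if p %% k == c then (- Posz (p %/ k)%N)%R else Posz (p %/ k).

Let k0 : 0 < k. Proof. lia. Qed.

Lemma runner_divn r i : r < k -> (r + k * i) %/ k = i /\ (r + k * i) %% k = r.
Proof.
by move=> rk; rewrite addnC mulnC divnMDl // modnMDl divn_small // modn_small // addn0.
Qed.

Lemma runner_eq r r' i i' : r < k -> r' < k ->
  (r + k * i == r' + k * i') = (r == r') && (i == i').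
Proof.
move=> rk r'k; apply/eqP/andP => [E|[/eqP -> /eqP ->] //].
have [d1 m1] := runner_divn i rk; have [d2 m2] := runner_divn i' r'k.
by rewrite E d2 in d1; rewrite E m2 in m1; rewrite d1 m1 !eqxx.
Qed.

Lemma runner_cases p : cls k p = c -> p != c ->
  (exists i, p = c + k * i.+1) \/ (two /\ exists i, p = k - c + k * i).
Proof.
move=> pc npc; have pE : p = p %% k + k * (p %/ k) by rewrite addnC mulnC -divn_eq.
have [E|E] : p %% k = c \/ p %% k != c /\ p %% k = k - c.
  by move: pc; rewrite /cls; lia.
  left; rewrite E in pE; case: (p %/ k) pE => [|i] pE; last by exists i.
  by move: npc; rewrite pE muln0 addn0 eqxx.
right; split; first by rewrite /two; lia.
by exists (p %/ k); rewrite -E.2.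
Qed.

Lemma runner_positionN i : runner_position (c + k * i.+1) = Negz i.
Proof.
have [] : (c + k * i.+1) %/ k = i.+1 /\ (c + k * i.+1) %% k = c by apply: runner_divn; lia.
by rewrite /runner_position => -> ->; rewrite eqxx NegzE.
Qed.

Lemma runner_positionP i : two -> runner_position (k - c + k * i) = Posz i.
Proof.
rewrite /two => t.
have [] : (k - c + k * i) %/ k = i /\ (k - c + k * i) %% k = k - c by apply: runner_divn; lia.
rewrite /runner_position => -> ->.
by have -> : (k - c == c) = false by lia.
Qed.

Let negz_eq e i : (Negz e == Negz i) = (e == i).
Proof. by apply/eqP/eqP => [[]|->]. Qed.

Let posz_eq e i : (Posz e == Posz i) = (e == i).
Proof. by apply/eqP/eqP => [[]|->]. Qed.

(** Three kinds of ribbons become one move: a single ribbon on runner [c] at a negative position,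
    one on runner [k - c] at a positive position, and the double ribbon with head [k - c] at
    position 0. *)
Lemma mv_runners p A : cls k p = c -> p != c ->
  mm (runner_position p) (runners_maya A) = omap runners_maya (mv k p A).
Proof.
have cm : c < k by lia.
have kcm : k - c < k by lia.
move=> pc npc; case: (runner_cases pc npc) => [[i ->]|[t [i ->]]].
  rewrite runner_positionN /mv /mm.
  have -> : (Negz i - 1)%R = Negz i.+1 by lia.
  have ki : k < c + k * i.+1 by rewrite mulnS; lia.
  have -> : (c + k * i.+1 < k) = false by lia.
  have -> : (c + k * i.+1 == k) = false by lia.
  have -> : c + k * i.+1 - k = c + k * i by rewrite mulnS; lia.
  rewrite /= negbK andbC; case: ifP => [/andP[-> /negPf ->]|] //=; last first.
    by case: (_ \in A) => //=; case: (_ \in A).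
  congr Some; apply/funext => -[e|e] /=.
    case: ltnP => //= t; rewrite !inE !runner_eq //.
    by have -> : (k - c == c) = false by lia.
  rewrite !inE !runner_eq // !eqxx /= !negz_eq.
  by case: (e == i) => //=; case: (e == i.+1).
rewrite runner_positionP // /mv /mm; move: (t); rewrite /two => ckt.
case: i => [|i].
  rewrite muln0 addn0 kcm; have -> : k < (k - c).*2 by lia.
  have -> : k - (k - c) = c by lia.
  have -> : (Posz 0 - 1)%R = Negz 0 by lia.
  have MP : runners_maya A (Posz 0) = (k - c \in A) by rewrite /= ckt muln0 addn0.
  have MN : runners_maya A (Negz 0) = (c \notin A) by rewrite /= muln0 addn0.
  rewrite MP MN negbK /=.
  case: (k - c \in A) => //=; case: (boolP (c \in A)) => //= cA.
  congr Some; apply/funext => -[e|e] /=.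
    rewrite ckt /= !inE.
    have -> : (k - c + k * e == c) = false.
      by have := @runner_eq (k - c) c e 0 kcm cm; rewrite muln0 addn0 => ->; lia.
    have -> : (k - c + k * e == k - c) = (e == 0).
      by have := @runner_eq (k - c) (k - c) e 0 kcm kcm; rewrite muln0 addn0 eqxx.
    by case: e.
  rewrite !inE.
  have -> : (c + k * e == c) = (e == 0).
    by have := @runner_eq c c e 0 cm cm; rewrite muln0 addn0 eqxx.
  have -> : (c + k * e == k - c) = false.
    by have := @runner_eq c (k - c) e 0 cm kcm; rewrite muln0 addn0 => ->; lia.
  by case: e.
have ki : k < k - c + k * i.+1 by rewrite mulnS; lia.
have -> : (k - c + k * i.+1 < k) = false by lia.
have -> : (k - c + k * i.+1 == k) = false by lia.
have -> : k - c + k * i.+1 - k = k - c + k * i by rewrite mulnS; lia.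
have -> : (Posz i.+1 - 1)%R = Posz i by lia.
rewrite /= ckt /=; case: ifP => [/andP[-> /negPf ->]|] //=; last first.
  by case: (_ \in A) => //=; case: (_ \in A).
congr Some; apply/funext => -[e|e] /=.
  rewrite ckt !inE !runner_eq // !eqxx /= !posz_eq.
  have [->|ne] := eqVneq e i.+1; last by case: (eqVneq e i).
  by have -> : (i.+1 == i) = false by lia.
rewrite !inE !runner_eq //.
by have -> : (c == k - c) = false by lia.
Qed.

(** [c] is at most half of [k], so it can only be the smaller bead of a double ribbon. *)
Lemma mv_runner_bottom A : mv k c A = None.
Proof.
rewrite /mv; have -> : c < k by lia.
have -> : (k < c.*2) = false by lia.
by case: ifP.
Qed.

Lemma filter_block i : [seq p <- iota (k * i).+1 k | cls k p == c] =
  k * i + c :: (if two then [:: k * i + (k - c)] else [::]).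
Proof.
apply: (irr_sorted_eq (leT := ltn)).
- exact: ltn_trans.
- exact: ltnn.
- by apply: sorted_filter; [exact: ltn_trans | exact: iota_ltn_sorted].
- by rewrite /two; case: ltnP => //= h; lia.
move=> p; rewrite mem_filter mem_iota; apply/andP/idP.
  move=> [/eqP pc pi]; have [r [pE r0 rk]] : exists r, [/\ p = k * i + r, 0 < r & r <= k].
    by exists (p - k * i); split; lia.
  have [rk'|rk'] : r < k \/ r = k by lia.
    move: pc; rewrite /cls pE mulnC modnMDl modn_small // => rc.
    by rewrite /two; case: ltnP => h; rewrite !inE; lia.
  by move: pc; rewrite /cls pE rk' -mulnSr modnMr; lia.
have modE r : r < k -> (k * i + r) %% k = r by move=> rk; rewrite mulnC modnMDl modn_small.
rewrite inE => /orP[/eqP ->|]; first by rewrite /cls modE; lia.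
by rewrite /two; case: ltnP => // h; rewrite inE => /eqP ->; rewrite /cls modE; lia.
Qed.

(** In increasing order the class reads [c], [k - c], [k + c], [2k - c], and so on, alternating
    between the two runners; without [c] these are the positions 0, -1, 1, and so on. If [2c = k],
    only the negative positions occur. *)
Lemma fold_positions n :
  [seq runner_position p | p <- [seq p <- [seq p <- iota 1 (k * n.+1) | cls k p == c] | p != c]] =
  fold_order two n.
Proof.
elim: n => [|n IHn].
  have := filter_block 0; rewrite muln1 muln0 add0n => -> /=; rewrite eqxx /=.
  rewrite /two; case: ltnP => //= h; have -> : k - c != c by lia.
  by have := @runner_positionP 0 h; rewrite muln0 addn0 /= => ->.
rewrite iota_mulS filter_cat filter_cat map_cat IHn filter_block /=; congr cat.
have -> : k * n.+1 + c != c by rewrite mulnS; lia.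
rewrite [k * n.+1 + c]addnC /= runner_positionN; congr cons.
rewrite /two; case: ltnP => //= h.
have -> : k * n.+1 + (k - c) != c by rewrite mulnS; lia.
by rewrite [k * n.+1 + _]addnC /= runner_positionP.
Qed.

Lemma opw_runners m n la : strict_partition la -> (forall q, q \in la -> q <= k * n.+1) ->
  opw (mv k) (let ps := [seq p <- iota 1 (k * n.+1) | cls k p == c] in
              wordw (vars m) (rev ps ++ ps))
    (fun A => (core_of k n.+1 c A)%:R%R) (seq_fsetn la) =
  Qpartition m (folded_shape k la c).
Proof.
move=> sla laN /=; have la0 : 0 \notin la by case/andP: sla.
have ckk : 0 < c <= k by lia.
set al := abacus k la c; pose be := if two then abacus k la (k - c) else [::].
have sal : strict_partition al by apply: abacus_strict.
have sbe : strict_partition be.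
  by rewrite /be /two; case: ltnP => // h; apply: abacus_strict => //; lia.
have abN r q : 0 < r <= k -> q \in abacus k la r -> q <= n.+1.
  move=> rk; rewrite abacus_mem // => /andP[q0 /laN qn].
  have : k * q.-1 < k * n.+1 by lia.
  by rewrite ltn_pmul2l //; lia.
have alN q : q \in al -> q <= n.+1 by apply: abN.
have beN q : q \in be -> q <= n.+1.
  by rewrite /be /two; case: ltnP => // h; apply: abN; lia.
set L := n + (if two then n.+1 else 0).
have M0E : runners_maya (seq_fsetn la) = two_runner_maya al be.
  apply/funext => -[i|i] /=.
    rewrite /be /two; case: ltnP => //= h.
    by rewrite abacus_mem ?seq_fsetnE //; lia.
  by rewrite /al abacus_mem ?seq_fsetnE.
set M0 := two_runner_maya al be in M0E.
have above j : (- n%:Z + L%:Z <= j)%R -> ~~ M0 j.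
  case: j => [i|i] /=; last by rewrite /L; lia.
  move=> iL; apply/negP => ib; have := beN _ ib; move: ib iL; rewrite /be /L /two.
  by case: ltnP => // _ _; lia.
have low j : (j < - n.+1%:Z)%R -> M0 j.
  case: j => [i|i] /=; first by lia.
  by move=> h; apply/negP => /alN; lia.
have [h [hole below hn]] : exists h, [/\ ~~ M0 h, forall j, (j < h)%R -> M0 j & (- n.+1%:Z <= h)%R].
  (* All positions below [-n.+1] are filled, so the search for the lowest hole can start there, over
     the naturals. *)
  have ex : exists i, ~~ M0 (i%:Z - n.+1%:Z)%R.
    by exists (n.+1 + (n + L)); apply: above; lia.
  case: (ex_minnP ex) => i iM imin; exists (i%:Z - n.+1%:Z)%R; split=> //; last by lia.
  move=> j ji; have [jn|jn] : (j < - n.+1%:Z)%R \/ (- n.+1%:Z <= j)%R by lia.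
    exact: low.
  apply: contrapT => /negP jM; have := imin (absz (j + n.+1%:Z)%R).
  have -> : ((absz (j + n.+1%:Z)%R)%:Z - n.+1%:Z)%R = j by lia.
  by move=> /(_ jM); lia.
(* From any [h] at least [-n.+1], a window of this length reaches past the largest possible bead and
   past the last visited position. *)
pose P := n.*2.+3 + n.+1.
have -> : folded_shape k la c = bead_partition (beads_above h P M0).
  have := @underlying_shape_combination al be h n.+1 P sal sbe alN beN hole below.
  move=> <-; last by rewrite /P; lia.
  by rewrite /folded_shape /be /two; case: ifP.
rewrite -(@opw_maya m n L P h M0) //; last by rewrite /P /L; case: two; lia.
(* The natural order of the Q-function side is replaced by the fold order, which is the order of the
   heads on the two runners. *)
rewrite -(weq_word _ _ _ (@weq_fold _ two n)) -M0E.
rewrite (@opw_drop _ _ _ (mv k) (fun _ => True) (fun p => p != c)) //; last first.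
  by move=> p A _; rewrite negbK => /eqP -> _; exact: mv_runner_bottom.
rewrite (@opw_sim _ _ _ (mv k) _ _ mm (fun _ => True) runners_maya runner_position _ _ _
  (fun M => (all (fun j => ~~ mm j M) (asc (- n%:Z)%R L))%:R%R)) //.
- rewrite filter_cat filter_rev map_cat map_rev.
  by rewrite fold_positions.
- move=> p A; rewrite mem_filter mem_cat mem_rev orbb mem_filter => /and3P[pc /eqP cp _] _.
  exact: mv_runners.
move=> A _; congr (nat_of_bool _)%:R%R.
rewrite -(eq_all_r (mem_fold_order two n)) -fold_positions all_map.
rewrite /core_of !all_filter; apply: eq_all => p /=.
case: (eqVneq (cls k p) c) => //= cp; case: (eqVneq p c) => [->|pc] /=.
  by rewrite mv_runner_bottom.
by rewrite mv_runners //; case: (mv k p A).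
Qed.

End PairOfRunners.

(** * Assembling the factors *)

Local Open Scope ring_scope.

Theorem mainTheorem3 (k : nat) (hk : (1 <= k)%N) (la : seq nat)
    (hla : strict_partition la) (m : nat) :
  RQ k m la =
    Qstrict m (abacus k la k) *
      \prod_(1 <= i < (k %/ 2).+1) Qpartition m (folded_shape k la i).
Proof.
(* The sum of the parts bounds each part; the bound is taken as a multiple of [k] so that the heads
   split into complete blocks of residues. *)
pose n := (\sum_(q <- la) q)%N.
have laN q : q \in la -> (q <= k * n.+1)%N.
  move=> qla; have : (q <= n)%N by rewrite /n (big_rem q) //= leq_addr.
  by move=> qn; rewrite (leq_trans qn) // (leq_trans (leqnSn n)) // leq_pmull.
rewrite (RQ_opw m hk hla laN) opw_mv_classes //.
rewrite /= big_cons opw_class0 //; congr *%R.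
rewrite /index_iota subn1 /=; apply: eq_big_seq => c; rewrite mem_iota => /andP[c0 ck].
by apply: opw_runners => //; move: ck; rewrite add1n ltnS leq_divRL // muln2.
Qed.
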